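(* There exist a subexponential distribution $F$ on ${\bf R}$ with a (finite) negative mean, a constant $c>0$, and sequences of positive integers $n_k\to\infty$ and of real numbers $x_k\to\infty$ such that, for all $k$, $$ \overline{F^{*n_k}}(x_k)\ge c\,\frac{n_k^2}{\ln n_k}\,\overline F(x_k). $$
   Context: For a distribution $F$ on ${\bf R}$, $\overline F(x)=F((x,\infty))$; $F^{*n}$ is the $n$-fold convolution of $F$ with itself (the distribution of the sum of $n$ independent random variables with distribution $F$), and $\overline{F^{*n}}(x)=F^{*n}((x,\infty))$. A distribution $G$ on ${\bf R}^+=[0,\infty)$ with unbounded support is called subexponential if $\overline{G*G}(x)/\overline G(x)\to 2$ as $x\to\infty$. A distribution $F$ on ${\bf R}$ is called subexponential if its conditional distribution on ${\bf R}^+$ (i.e. $F(\cdot\cap{\bf R}^+)/F({\bf R}^+)$) is subexponential. *)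

(* Defs.v *)
From HB Require Import structures.
From mathcomp Require Import all_boot all_order all_algebra.
From mathcomp Require Import all_classical all_reals all_analysis.

Set Implicit Arguments.
Unset Strict Implicit.
Unset Printing Implicit Defensive.

Import Order.TTheory GRing.Theory Num.Theory.
Import numFieldNormedType.Exports.

Local Open Scope classical_set_scope.
Local Open Scope ring_scope.

Notation distr R := (probability R R).

Section Distributions.
Variable R : realType.
Implicit Types F G : distr R.

Definition tail F (x : R) : R := fine (F `]x, +oo[%classic).

Definition add_pair (p : R * R) : R := p.1 + p.2.

Lemma measurable_add_pair : measurable_fun [set: _] add_pair.
Proof. by apply: measurable_realfun.measurable_funD. Qed.

HB.instance Definition _ :=
  isMeasurableFun.Build _ _ _ _ add_pair measurable_add_pair.

Definition convolution F G : distr R := distribution (F \x G)%E add_pair.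

(* The n-fold F^{*n}; the empty sum is 0, so F^{*0} is the point mass at 0. *)
Fixpoint convolution_pow F (n : nat) : distr R :=
  if n is m.+1 then convolution (convolution_pow F m) F else dirac (0 : R).

Definition Rplus : set R := `[0, +oo[%classic.

Lemma measurable_Rplus : measurable Rplus.
Proof. exact: measurable_itv. Qed.

Definition msupport F : set R :=
  [set x | forall U : set R, open U -> U x -> (0 < F U)%E].

Definition subexponential_nneg G : Prop :=
  [/\ G Rplus = 1%E,
      ~ bounded_set (msupport G) &
      tail (convolution G G) x / tail G x @[x --> +oo] --> (2 : R)].

(* F ( . `&` Rplus) / F Rplus; the point mass at 0 is the value that mnormalize
   takes when F Rplus = 0, in which case there is no conditional distribution. *)
Definition cond_Rplus F : distr R :=
  mnormalize (mrestr F measurable_Rplus) (dirac (0 : R)).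

Definition subexponential F : Prop :=
  (0 < F Rplus)%E /\ subexponential_nneg (cond_Rplus F).

End Distributions.

(* Main.v *)
Require Import Defs.
From HB Require Import structures.
From mathcomp Require Import all_boot all_order all_algebra.
From mathcomp Require Import all_classical all_reals all_analysis.
From mathcomp Require Import measurable_realfun zify ring lra.

(** The example is a law with a single negative atom and a positive part that
    mixes exponential laws on wildly separated scales:

      [F = (1 - t_0) delta_{-16} + sum_j p_j Exp(1 / n_j)],

    with [p_j = t_j - t_{j+1}] and [t_j = n_j^-2], so that for [x >= 0]
    [tail F x = sum_j p_j exp(- x / n_j)].  The scales grow like
    [n_{j+1} = exp(c n_j^2 / ln n_j)]; precisely [n_j = 2 ^ a_j] with
    [a_j * a_{j+1} = n_j ^ 2].

    Component [j] gives way to component [j+1] in this tail at the crossing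
    point [x_j = 2 n_j ln (n_{j+1} / n_j)], where
    [exp(- x_j / n_j) = (n_j / n_{j+1})^2].  The relation between the scales
    makes [x_j / n_j] comparable to [n_j^2 / ln n_j].

    Subexponentiality.  Let [G] be the normalised positive part.  A sum of
    two exponentials of different rates [r_i], [r_j] has tail at most
    [exp(- r_i x) + exp(- r_j x)] up to factors [1 + 2 / a], because the
    scales are well separated ([exponential_pair_le]); summed over all pairs
    this gives twice [tail G].  Equal rates contribute an excess
    [p_j^2 (x / n_j) exp(- x / n_j)].  Before [x_j] this is
    [p_j x / n_j <= O(1 / ln n_j)] times the [j]-th term of the tail, and well
    past [x_j] it is dominated by the next term ([diagonal_term_le]).  Hence
    [tail (G * G) x <= 2 tail G x + o(tail G x)]
    ([hyper_convolution_le], [hyper_convolution_cvg]).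

    Lower bound.  The excess of equal rates is thus negligible only by a
    logarithm: at [x_j] two jumps from component [j] still exceed the tail by
    the factor [p_j x_j / n_j], of order [1 / ln n_j].  Take [n_j] summands.
    There are about [n_j^2 / 2] pairs that can both jump; since
    [n_j p_j <= 1 / n_j], the remaining summands avoid component [j] with
    probability at least [1/2]; and, as every step is at least [-16], they
    lower the sum by at most [16 n_j], which costs only the factor [exp(-16)]
    because component [j] lives on the scale [n_j]
    ([two_jump_lower_bound]).  So [F^{*n_j}] has tail at least
    [c n_j^2 / ln n_j] times [tail F] at [x_j]
    ([convolution_pow_crossing]). *)

Import Order.TTheory GRing.Theory Num.Theory.
Import numFieldNormedType.Exports.

Set Implicit Arguments.
Unset Strict Implicit.
Unset Printing Implicit Defensive.

(** * The scales *)

(** Scales are double powers of two, which lets the growth relation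
    [a_j * a_{j+1} = n_j ^ 2] hold exactly over the integers: if
    [a_j = 2 ^ b_j], it says [b_j + b_{j+1} = 2 ^ (b_j + 1)]. *)
Fixpoint loglog_scale (j : nat) : nat :=
  if j is i.+1 then 2 ^ (loglog_scale i).+1 - loglog_scale i else 0.

Definition log_scale (j : nat) : nat := 2 ^ loglog_scale j.

Definition scale (j : nat) : nat := 2 ^ log_scale j.

Arguments loglog_scale : simpl never.
Arguments log_scale : simpl never.
Arguments scale : simpl never.

Lemma loglog_scaleS j :
  (loglog_scale j.+1 + loglog_scale j = 2 ^ (loglog_scale j).+1)%N.
Proof. by rewrite {1}/loglog_scale -/loglog_scale subnK// ltnW// ltnW// ltn_expl. Qed.

Lemma ltn_loglog_scale j : (loglog_scale j < loglog_scale j.+1)%N.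
Proof.
have := loglog_scaleS j; have := ltn_expl (loglog_scale j) (isT : 1 < 2)%N.
rewrite expnS; move: (2 ^ _)%N => e; lia.
Qed.

Lemma leq_loglog_scale j : (j <= loglog_scale j)%N.
Proof. by elim: j => // j /leq_ltn_trans; apply; exact: ltn_loglog_scale. Qed.

(** This is what makes [ln n_{j+1}] comparable to [n_j^2 / ln n_j]. *)
Lemma log_scaleM j : (log_scale j.+1 * log_scale j = scale j ^ 2)%N.
Proof. by rewrite /scale /log_scale -expnD loglog_scaleS -expnM expnSr. Qed.

Lemma leq_log_scaleS j : (2 * log_scale j <= log_scale j.+1)%N.
Proof. by rewrite -expnS leq_exp2l// ltn_loglog_scale. Qed.

Lemma log_scale_gt0 j : (0 < log_scale j)%N.
Proof. by rewrite expn_gt0. Qed.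

Lemma log_scale_double i j : (i < j)%N -> (2 * log_scale i <= log_scale j)%N.
Proof.
elim: j => // j ih; rewrite ltnS leq_eqVlt => /orP[/eqP ->|/ih ij].
  exact: leq_log_scaleS.
apply: (leq_trans ij); apply: leq_trans (leq_log_scaleS j).
by rewrite leq_pmull.
Qed.

Lemma leq_log_scale i j : (i <= j)%N -> (log_scale i <= log_scale j)%N.
Proof.
rewrite leq_eqVlt => /orP[/eqP -> //|/log_scale_double].
by apply: leq_trans; rewrite leq_pmull.
Qed.

Lemma ltn_log_scale j : (j < log_scale j)%N.
Proof. by rewrite (leq_ltn_trans (leq_loglog_scale j))// ltn_expl. Qed.

Lemma ltn_scale j : (j < scale j)%N.
Proof. by rewrite (ltn_trans (ltn_log_scale j))// ltn_expl. Qed.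

Lemma scale_gt0 j : (0 < scale j)%N.
Proof. by rewrite expn_gt0. Qed.

Lemma scale_gt1 j : (1 < scale j)%N.
Proof. by rewrite -[1%N](expn0 2) ltn_exp2l// log_scale_gt0. Qed.

Lemma leq_scale i j : (i <= j)%N -> (scale i <= scale j)%N.
Proof. by move=> ij; rewrite leq_exp2l// leq_log_scale. Qed.

Lemma leq_scaleS_sqr j : (scale j ^ 2 <= scale j.+1)%N.
Proof. by rewrite -expnM leq_exp2l// mulnC leq_log_scaleS. Qed.

(** Quantifies the separation of the scales as [n_i / (n_j - n_i) <= 2 / a_j],
    without subtraction. *)
Lemma scale_gap i j : (i < j)%N -> (scale i * (log_scale j + 2) <= 2 * scale j)%N.
Proof.
move=> ij; have /subnK <- : (log_scale i <= log_scale j)%N by rewrite leq_log_scale// ltnW.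
have := log_scale_double ij.
rewrite {2}/scale; set d := (log_scale j - log_scale i)%N => h.
have dj : (log_scale j = d + log_scale i)%N by rewrite subnK// leq_log_scale// ltnW.
rewrite dj expnD mulnA mulnC leq_mul2r; apply/orP; right.
move: h; rewrite dj; have := ltn_expl d (isT : (1 < 2)%N).
move: (2 ^ d)%N => e; lia.
Qed.

Local Open Scope classical_set_scope.
Local Open Scope ring_scope.

Lemma eq_imp_le {R : numDomainType} (x y : R) : x = y -> x <= y.
Proof. by move->. Qed.

(** * Series of nonnegative reals *)

Section real_series.
Context {R : realType}.
Implicit Types f g : nat -> R.
Local Open Scope ereal_scope.

Lemma series_EFinD f g : (forall i, 0 <= f i)%R -> (forall i, 0 <= g i)%R ->
  \sum_(i <oo) (f i + g i)%:E = \sum_(i <oo) (f i)%:E + \sum_(i <oo) (g i)%:E.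
Proof.
by move=> f0 g0; rewrite -nneseriesD// => i _ _; rewrite lee_fin.
Qed.

Lemma series_EFinZ c f : (forall i, 0 <= f i)%R ->
  \sum_(i <oo) (c * f i)%:E = c%:E * \sum_(i <oo) (f i)%:E.
Proof. by move=> f0; rewrite -nneseriesZl// => i _; rewrite lee_fin. Qed.

Lemma series_EFin_le f g : (forall i, 0 <= f i)%R -> (forall i, f i <= g i)%R ->
  \sum_(i <oo) (f i)%:E <= \sum_(i <oo) (g i)%:E.
Proof. by move=> f0 fg; apply: lee_nneseries => i *; rewrite lee_fin. Qed.

Lemma series_single n (v : R) : (0 <= v)%R ->
  \sum_(i <oo) (if i == n then v else 0%R)%:E = v%:E.
Proof.
move=> v0; rewrite (@nneseriesD1 _ _ n)//; last by move=> k _; case: ifP; rewrite lee_fin.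
rewrite eqxx eseries0 ?adde0// => i _ /= ni.
by rewrite (negbTE ni).
Qed.

Lemma series_ge_term f n : (forall i, 0 <= f i)%R ->
  (f n)%:E <= \sum_(i <oo) (f i)%:E.
Proof.
move=> f0; rewrite (@nneseriesD1 _ _ n)//; last by move=> k _; rewrite lee_fin.
by rewrite leeDl// nneseries_ge0// => k _ _; rewrite lee_fin.
Qed.

Lemma series_recl (u : nat -> \bar R) : (forall i, 0 <= u i) ->
  \sum_(i <oo) u i = u 0%N + \sum_(i <oo) u i.+1.
Proof.
move=> u0; rewrite nneseries_recl//; congr (_ + _).
by rewrite -(@nneseries_addn _ _ 1)//; apply: eq_eseriesr => i _; rewrite addn1.
Qed.

Lemma series_shift_le f : (forall i, 0 <= f i)%R ->
  \sum_(i <oo) (f i.+1)%:E <= \sum_(i <oo) (f i)%:E.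
Proof.
move=> f0; rewrite [leRHS]series_recl; last by move=> i; rewrite lee_fin.
by rewrite leeDr// lee_fin.
Qed.

End real_series.

(** * Exponential laws *)

Section density.
Context d (T : measurableType d) (R : realType).
Variables (nu : {finite_measure set T -> \bar R})
          (mu : {sigma_finite_measure set T -> \bar R}) (h : T -> \bar R).
Local Open Scope ereal_scope.

(** The density [h] agrees almost everywhere with the Radon-Nikodym derivative,
    for which the change of variables is known. *)
Lemma ge0_integral_density (f : T -> \bar R) :
    measurable_fun setT h ->
    (forall A, measurable A -> nu A = \int[mu]_(x in A) h x) ->
    measurable_fun setT f -> (forall x, 0 <= f x) ->
  \int[nu]_x f x = \int[mu]_x (f x * h x).
Proof.
move=> mh nuE mf f0.
have numu : nu `<< mu.
  apply/null_content_dominatesP => A mA muA0; rewrite nuE//.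
  by apply: null_set_integral => //; exact: measurable_funTS.
rewrite -(Radon_Nikodym_SigmaFinite.change_of_variables numu)//.
have mRN := measurable_int _ (Radon_Nikodym_SigmaFinite.f_integrable numu).
apply: ae_eq_integral => //; [exact: emeasurable_funM..|].
apply: ae_eqe_mul2l; apply: integral_ae_eq => //.
  exact: Radon_Nikodym_SigmaFinite.f_integrable.
by move=> E _ mE; rewrite -Radon_Nikodym_SigmaFinite.f_integral// nuE.
Qed.

End density.

Lemma measurable_expRM {R : realType} (a : R) :
  measurable_fun setT (fun x : R => expR (a * x)).
Proof. by apply: measurableT_comp => //; exact: mulrl_measurable. Qed.

Section exponential.
Context {R : realType}.
Implicit Types (s x y : R) (l : {posnum R}).
Notation mu := (@lebesgue_measure R).

(* exponential_prob is a measure for the Borel structure generated by half-open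
   intervals, a different canonical structure from the one carried by R; the
   identity transports it. *)
Let borel_id : measurableTypeR R -> R := idfun.

#[local] HB.instance Definition _ :=
  @isMeasurableFun.Build _ _ _ _ borel_id (@measurable_id _ _ setT).

Definition expo l : distr R :=
  distribution (exponential_distribution_exponential_prob__canonical__probability_measure_Probability (gt0 l))
    borel_id.

Lemma expoE l A : expo l A = exponential_prob l%:num A.
Proof. by []. Qed.

Lemma ge0_integral_expo l (f : R -> R) :
  measurable_fun setT f -> (forall x, 0 <= f x) ->
  (\int[expo l]_x (f x)%:E =
   \int[mu]_(x in `[0%R, +oo[) (f x * (l%:num * expR (- l%:num * x)))%:E)%E.
Proof.
move=> mf f0.
rewrite ge0_integral_distribution//; last exact/measurable_EFinP.
rewrite (@ge0_integral_density _ _ _ _ mu (EFin \o exponential_pdf l%:num))//.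
- rewrite [RHS]integral_mkcond; apply: eq_integral => x _ /=.
  rewrite -EFinM /exponential_pdf !patchE; case: ifPn => // _.
  by rewrite mulr0.
- apply/measurable_EFinP; exact: measurable_exponential_pdf.
- exact/measurable_EFinP.
Qed.

(** At [x = 0] this uses that an exponential law has no atom. *)
Lemma expo_tail l x : expo l `]x, +oo[%classic = (expR (- l%:num * Num.max 0 x))%:E.
Proof.
have neg : expo l `]-oo, 0[%classic = 0%E.
  rewrite expoE /exponential_prob integral0_eq// => y /=.
  by rewrite in_itv/= => y0; rewrite lt0_exponential_pdf.
have nonneg y : 0 < y ->
    expo l `]y, +oo[%classic = (expR (- l%:num * y))%:E.
  move=> y0.
  have -> : `]y, +oo[%classic = ~` (`]-oo, 0[%classic `|` `[0, y]%classic).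
    by rewrite -itv_bndbnd_setU ?bnd_simp ?ltW// setCitvl.
  rewrite probability_setC; last exact: measurableU.
  rewrite measureU//; last first.
    by apply/seteqP; split=> z //= []; rewrite !in_itv/= => zn /andP[]; lra.
  rewrite [X in (_ - (X + _))%E]neg add0e [X in (_ - X)%E]exponential_prob_itv0c//.
  by rewrite -EFinB; congr (_%:E); ring.
have [x0|x0] := ltP 0 x; first by rewrite nonneg.
rewrite mulr0 expR0 -setCitvl probability_setC//.
suff -> : expo l `]-oo, x]%classic = 0%E by rewrite sube0.
apply/eqP; rewrite eq_le measure_ge0 andbT.
have le : (expo l `]-oo, x]%classic <= expo l (`]-oo, 0%R[%classic `|` [set 0%R]))%E.
  apply: le_measure; rewrite ?inE//; first exact: measurableU.
  move=> y /=; rewrite in_itv/= => yx; rewrite in_itv/=.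
  by have : y <= 0 by [lra]; rewrite le_eqVlt => /orP[/eqP|]; [right|left].
apply: (le_trans le); rewrite measureU//; last first.
  by apply/seteqP; split=> z //= []; rewrite in_itv/= => /[swap] ->; rewrite ltxx.
rewrite [X in (X + _)%E]neg add0e [X in (X <= _)%E]expoE /exponential_prob.
by rewrite integral_set1.
Qed.

Lemma ge0_integral_expo_le l (f g : R -> R) :
  measurable_fun setT f -> measurable_fun setT g ->
  (forall x, 0 <= f x) -> (forall x, 0 <= g x) ->
  (forall x, 0 <= x -> f x <= g x) ->
  (\int[expo l]_x (f x)%:E <= \int[expo l]_x (g x)%:E)%E.
Proof.
move=> mf mg f0 g0 fg; rewrite !ge0_integral_expo//.
have md : measurable_fun setT (fun x : R => l%:num * expR (- l%:num * x)).
  by apply: measurable_funM => //; exact: measurable_expRM.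
apply: ge0_le_integral => //=.
- by move=> x _; rewrite lee_fin !mulr_ge0 ?expR_ge0.
- by apply/measurable_EFinP/measurable_funTS; exact: measurable_funM.
- by apply/measurable_EFinP/measurable_funTS; exact: measurable_funM.
- move=> x; rewrite in_itv/= andbT => x0.
  by rewrite lee_fin ler_wpM2r ?fg// mulr_ge0 ?expR_ge0.
Qed.

(** Tilting by [exp (s x)] turns the density of rate [l] into a multiple of the
    density of rate [l - s]. *)
Lemma expo_mgf l s : s < l%:num ->
  (\int[expo l]_x (expR (s * x))%:E = (l%:num / (l%:num - s))%:E)%E.
Proof.
move=> sl; have ls0 : 0 < l%:num - s by rewrite subr_gt0.
rewrite ge0_integral_expo//; last exact: measurable_expRM.
pose k := PosNum ls0.
have := @ge0_integral_expo k (cst (l%:num / (l%:num - s))).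
move=> /(_ (measurable_cst _)); rewrite /= integral_cst// [X in (_ * X)%E]probability_setT mule1.
move=> ->; last by move=> _; rewrite divr_ge0// ltW.
apply: eq_integral => x _; congr (_%:E).
have -> : expR (- (l%:num - s) * x) = expR (s * x) * expR (- l%:num * x).
  by rewrite -expRD; congr expR; ring.
by field; rewrite gt_eqF.
Qed.

(** At the critical tilt the weighted density is constant; this is the source
    of the factor [l x] in the sum of two exponentials of the same rate. *)
Lemma expo_truncated_mgf l x : 0 <= x ->
  (\int[expo l]_y (expR (l%:num * y) * \1_(`[0, x]) y)%:E = (l%:num * x)%:E)%E.
Proof.
move=> x0.
rewrite ge0_integral_expo//; last first.
  by apply: measurable_funM => //; exact: measurable_expRM.
transitivity (\int[mu]_(y in `[0%R, x]) (l%:num)%:E)%E.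
  rewrite [LHS]integral_mkcond [RHS]integral_mkcond; apply: eq_integral => y _.
  rewrite !patchE !mem_setE indicE !in_itv/= andbT.
  have -> : (y \in `[0, x]%classic) = (0 <= y <= x).
    by rewrite mem_setE in_itv.
  case: (0 <= y) => //=; case: (y <= x) => /=; last by rewrite mulr0 mul0r.
  by rewrite mulr1 mulrCA -expRD mulNr subrr expR0 mulr1.
rewrite integral_cst//= lebesgue_measure_itv/= lte_fin.
case: ifPn => [_|]; first by rewrite -EFinB subr0.
by rewrite -leNgt => x0'; have -> : x = 0 by [lra]; rewrite mulr0 mule0.
Qed.

End exponential.

Arguments expo : simpl never.

(** * Tails of convolutions and mixtures *)

Section tails.
Context {R : realType}.
Implicit Types (P Q : distr R) (x y : R).

Lemma tailE P x : P `]x, +oo[%classic = (tail P x)%:E.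
Proof. by rewrite /tail fineK// fin_num_measure. Qed.

Lemma tail_ge0 P x : 0 <= tail P x.
Proof. by rewrite -lee_fin -tailE measure_ge0. Qed.

Lemma tail_le1 P x : tail P x <= 1.
Proof. by rewrite -lee_fin -tailE probability_le1. Qed.

Lemma tail_nonincreasing P : {homo tail P : x y / x <= y >-> y <= x}.
Proof.
move=> x y xy; rewrite -lee_fin -!tailE le_measure ?inE//.
by apply: subset_itvr; rewrite bnd_simp.
Qed.

Lemma nondecreasing_tail_subr P x : {homo (fun y => tail P (x - y)) : y z / y <= z}.
Proof. by move=> y z yz; apply: tail_nonincreasing; rewrite lerB. Qed.

Lemma measurable_tail_subr P x : measurable_fun setT (fun y => tail P (x - y)).
Proof.
by apply: nondecreasing_measurable => //; exact: nondecreasing_tail_subr.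
Qed.

(** Conditioning on either summand: the two orders of integration over the
    product measure. *)
Lemma convolution_tailr P Q x :
  ((tail (convolution P Q) x)%:E = \int[P]_y (tail Q (x - y))%:E)%E.
Proof.
rewrite -tailE; apply: eq_integral => y _.
rewrite -tailE /=; congr (Q _); apply/seteqP; split=> z; rewrite /xsection /= inE /=.
  by rewrite !in_itv/= !andbT /Defs.add_pair /= ltrBlDl.
by rewrite !in_itv/= !andbT /Defs.add_pair /= ltrBlDl.
Qed.

Lemma convolution_taill P Q x :
  ((tail (convolution P Q) x)%:E = \int[Q]_y (tail P (x - y))%:E)%E.
Proof.
rewrite -tailE.
transitivity ((P \x^ Q)%E (@Defs.add_pair R @^-1` `]x, +oo[%classic)).
  apply: product_measure_unique; last first.
    by rewrite -[X in measurable X]setTI; exact: measurable_add_pair.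
  by move=> A B mA mB; exact: product_measure2E.
apply: eq_integral => y _.
rewrite -tailE /=; congr (P _); apply/seteqP; split=> z; rewrite /ysection /= inE /=.
  by rewrite !in_itv/= !andbT /Defs.add_pair /= ltrBlDr.
by rewrite !in_itv/= !andbT /Defs.add_pair /= ltrBlDr.
Qed.

End tails.

Lemma mnormalize_mass1 d (T : measurableType d) (R : realType)
    (m : {measure set T -> \bar R}) (P : probability T R) A :
  (m [set: T] = 1 -> mnormalize m P A = m A)%E.
Proof. by rewrite /mnormalize => ->; rewrite onee_eq0/= invr1 mule1. Qed.

Section mixture.
Context {R : realType}.
Variables (w : nat -> {nonneg R}) (P : nat -> distr R).
Local Open Scope ereal_scope.

Let weighted_sum := mseries (fun i => mscale (w i) (P i)) 0.

(** Normalisation makes this a probability for any weights; it is the identity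
    when the weights sum to 1. *)
Definition mixture : distr R := mnormalize weighted_sum (P 0%N).

Hypothesis w1 : \sum_(i <oo) (w i)%:num%:E = 1.

Lemma mixtureE A : mixture A = \sum_(i <oo) (w i)%:num%:E * P i A.
Proof.
have e1 : weighted_sum [set: R] = 1.
  rewrite -w1; apply: eq_eseriesr => i _ /=.
  by rewrite /mscale/= [X in _ * X](_ : _ = 1) ?mule1//; exact: probability_setT.
exact: (mnormalize_mass1 _ _ e1).
Qed.

Lemma ge0_integral_mixture (f : R -> \bar R) :
  measurable_fun setT f -> (forall x, 0 <= f x) ->
  \int[mixture]_x f x = \sum_(i <oo) (w i)%:num%:E * \int[P i]_x f x.
Proof.
move=> mf f0.
rewrite (@eq_measure_integral _ _ _ _ weighted_sum); last first.
  by move=> A mA _; exact: mixtureE.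
rewrite ge0_integral_measure_series//; apply: eq_eseriesr => i _.
by rewrite ge0_integral_mscale.
Qed.

Lemma mixture_tail x :
  (tail mixture x)%:E = \sum_(i <oo) ((w i)%:num * tail (P i) x)%:E.
Proof.
by rewrite -tailE mixtureE; apply: eq_eseriesr => i _; rewrite EFinM -tailE.
Qed.

End mixture.

Arguments mixture : simpl never.

Section mixture_convolution.
Context {R : realType}.
Variables (w : nat -> {nonneg R}) (P : nat -> distr R).
Hypothesis w1 : (\sum_(i <oo) (w i)%:num%:E = 1)%E.

(** Integrating out the first summand, going back to a convolution with one
    component, and integrating out the second one expands both mixtures without
    ever exchanging a series with an integral. *)
Lemma mixture_convolution_tail x :
  ((tail (convolution (mixture w P) (mixture w P)) x)%:E =
   \sum_(i <oo) (w i)%:num%:E *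
     \sum_(j <oo) ((w j)%:num * tail (convolution (P i) (P j)) x)%:E)%E.
Proof.
have mt Q z : measurable_fun [set: R] (fun y => (tail Q (z - y))%:E).
  by apply/measurable_EFinP; exact: measurable_tail_subr.
rewrite convolution_tailr ge0_integral_mixture//; last first.
  by move=> y; rewrite lee_fin tail_ge0.
apply: eq_eseriesr => i _; congr (_ * _)%E.
rewrite -convolution_tailr convolution_taill ge0_integral_mixture//; last first.
  by move=> y; rewrite lee_fin tail_ge0.
by apply: eq_eseriesr => j _; rewrite EFinM convolution_taill.
Qed.

End mixture_convolution.

(** * Sums of two independent variables *)

Section exponential_convolutions.
Context {R : realType}.
Implicit Types (l k : {posnum R}) (x y : R).

Lemma tail_expo l x : tail (expo l) x = expR (- l%:num * Num.max 0 x).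
Proof. by rewrite /tail expo_tail. Qed.

Lemma tail_expo_le l x : tail (expo l) x <= expR (- l%:num * x).
Proof. by rewrite tail_expo ler_expR ler_wnM2l ?oppr_le0// le_max lexx orbT. Qed.

(** The slower exponential, of rate [k], carries the tail: a faster summand [y]
    multiplies it by [exp (k y)], whose mean is [l / (l - k)]. *)
Lemma integral_tail_expo_le l k x : k%:num < l%:num ->
  (\int[expo l]_y (tail (expo k) (x - y))%:E <=
   (expR (- k%:num * x) * (l%:num / (l%:num - k%:num)))%:E)%E.
Proof.
move=> kl.
apply: (@le_trans _ _ (\int[expo l]_y (expR (- k%:num * x) * expR (k%:num * y))%:E)%E).
  apply: ge0_integral_expo_le => //.
  - exact: measurable_tail_subr.
  - by apply: measurable_funM => //; exact: measurable_expRM.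
  - by move=> y; exact: tail_ge0.
  move=> y _; rewrite (le_trans (tail_expo_le _ _))// -expRD ler_expR; lra.
under eq_integral do rewrite EFinM.
rewrite ge0_integralZl//=; last by apply/measurable_EFinP; exact: measurable_expRM.
by rewrite expo_mgf.
Qed.

Lemma convolution_expo_ltl l k x : k%:num < l%:num ->
  tail (convolution (expo l) (expo k)) x <=
  expR (- k%:num * x) * (l%:num / (l%:num - k%:num)).
Proof. by move=> kl; rewrite -lee_fin convolution_tailr integral_tail_expo_le. Qed.

Lemma convolution_expo_ltr l k x : k%:num < l%:num ->
  tail (convolution (expo k) (expo l)) x <=
  expR (- k%:num * x) * (l%:num / (l%:num - k%:num)).
Proof. by move=> kl; rewrite -lee_fin convolution_taill integral_tail_expo_le. Qed.

(** Either one summand exceeds [x] alone, or it lies in [[0, x]] and the other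
    makes up the difference; on [[0, x]] the critical tilt applies. *)
Lemma convolution_expo_diag l x : 0 <= x ->
  tail (convolution (expo l) (expo l)) x <= expR (- l%:num * x) * (1 + l%:num * x).
Proof.
move=> x0; rewrite -lee_fin convolution_tailr.
have mt : measurable_fun setT (\1_(`]x, +oo[) : R -> R) by exact: measurable_indic.
have me : measurable_fun setT
    (fun y => expR (l%:num * y) * \1_(`[0, x]) y).
  by apply: measurable_funM => //; exact: measurable_expRM.
apply: (@le_trans _ _ (\int[expo l]_y (\1_(`]x, +oo[) y +
    expR (- l%:num * x) * (expR (l%:num * y) * \1_(`[0%R, x]) y))%:E)%E).
  apply: ge0_integral_expo_le => //.
  - exact: measurable_tail_subr.
  - by apply: measurable_funD => //; exact: measurable_funM.
  - by move=> y; exact: tail_ge0.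
  move=> y y0; rewrite !indicE !mem_setE !in_itv/= andbT y0/=.
  have [yx|yx] := ltP x y.
    by rewrite !mulr0 addr0 tail_le1.
  rewrite add0r mulr1 -expRD (le_trans (tail_expo_le _ _))// ler_expR; lra.
under eq_integral do rewrite EFinD EFinM.
rewrite ge0_integralD//=; last 2 first.
- exact/measurable_EFinP.
- by apply/measurable_EFinP; exact: measurable_funM.
rewrite ge0_integralZl//=; last exact/measurable_EFinP.
rewrite integral_indic// setIT expo_truncated_mgf//.
rewrite [X in (X + _)%E]expo_tail max_r// -EFinM -EFinD lee_fin.
by rewrite mulrDr mulr1.
Qed.

End exponential_convolutions.

Section nonnegative.
Context {R : realType}.
Implicit Types (P : distr R) (x : R).

Lemma tail_nneg P x : P (@Rplus R) = 1%E -> x < 0 -> tail P x = 1.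
Proof.
move=> P1 x0; apply/eqP; rewrite eq_le tail_le1/= -lee_fin -tailE -P1.
apply: le_measure; rewrite ?inE//; first exact: measurable_Rplus.
by apply: subset_itvr; rewrite bnd_simp.
Qed.

(** For nonnegative summands the sum exceeds [x] as soon as one of them does;
    this is inclusion-exclusion for that event. *)
Lemma tail_convolution_ge P x : P (@Rplus R) = 1%E -> 0 <= x ->
  2 * tail P x - tail P x ^+ 2 <= tail (convolution P P) x.
Proof.
move=> P1 x0.
have P0x : P `[0, x]%classic = (1 - tail P x)%:E.
  have : (P (@Rplus R) = P `[0%R, x]%classic + P `]x, +oo[%classic)%E.
    rewrite -measureU//; last first.
      by apply/seteqP; split=> z //= []; rewrite !in_itv/= => /andP[_ ?]; lra.
    by rewrite -itv_bndbnd_setU ?bnd_simp.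
  rewrite P1 tailE EFinB => ->; rewrite -addeA subee ?adde0//.
rewrite -lee_fin convolution_tailr.
apply: (@le_trans _ _ (\int[P]_y (\1_(`]x, +oo[) y + tail P x * \1_(`[0%R, x]) y)%:E)%E).
  under eq_integral do rewrite EFinD EFinM.
  have mi (A : set R) : measurable A -> measurable_fun setT (fun y : R => (\1_A y : R)%:E).
    by move=> mA; apply/measurable_EFinP.
  rewrite ge0_integralD//=; last 3 first.
  - exact: mi.
  - by move=> y _; rewrite mule_ge0// lee_fin tail_ge0.
  - by apply: emeasurable_funM => //; exact: mi.
  rewrite ge0_integralZl//=; last 2 first.
  - exact: mi.
  - by rewrite lee_fin tail_ge0.
  rewrite !integral_indic// !setIT [X in (_ * X)%E]P0x [X in (X + _)%E]tailE.
  rewrite -EFinM -EFinD lee_fin.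
  by apply: eq_imp_le; ring.
apply: ge0_le_integral => //=.
- by move=> y _; rewrite lee_fin addr_ge0// mulr_ge0// tail_ge0.
- by apply/measurable_EFinP; apply: measurable_funD => //; apply: measurable_funM.
- by apply/measurable_EFinP; exact: measurable_tail_subr.
move=> y _; rewrite lee_fin !indicE !mem_setE !in_itv/= andbT.
have [yx|yx] := ltP x y; first by rewrite andbF mulr0 addr0 tail_nneg// subr_lt0.
rewrite andbT add0r; have [y0|y0] := leP 0 y.
  by rewrite mulr1 tail_nonincreasing// gerBl.
by rewrite mulr0 tail_ge0.
Qed.

End nonnegative.

(** * Weights and rates of the components *)

Section weights.
Context {R : realType}.
Implicit Types (x : R) (i j m : nat).

Let scale_pos j : 0 < (scale j)%:R^-1 :> R.
Proof. by rewrite invr_gt0 ltr0n scale_gt0. Qed.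

Definition rate j : {posnum R} := PosNum (scale_pos j).

Definition decay j x : R := expR (- (rate j)%:num * x).

(** The weights are increments of this sequence, so that their sums telescope:
    it is the total weight of the components from [j] on. *)
Definition remaining_mass j : R := (scale j)%:R ^- 2.

Lemma rateE j : (rate j)%:num = (scale j)%:R^-1. Proof. by []. Qed.

Lemma scaleR_ge2 j : 2 <= (scale j)%:R :> R.
Proof. by rewrite ler_nat scale_gt1. Qed.

Lemma scaleRS_ge j : (scale j)%:R ^+ 2 <= (scale j.+1)%:R :> R.
Proof. by rewrite -natrX ler_nat leq_scaleS_sqr. Qed.

Lemma remaining_mass_gt0 j : 0 < remaining_mass j.
Proof. by rewrite invr_gt0 exprn_gt0// ltr0n scale_gt0. Qed.

Lemma remaining_massS_le j : remaining_mass j.+1 <= remaining_mass j / 4.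
Proof.
have := scaleR_ge2 j; have := scaleRS_ge j; rewrite /remaining_mass -invfM.
move: (scale j)%:R (scale j.+1)%:R => n N hS h.
have nN : 2 * n <= N by nra.
have nN2 : n ^+ 2 * 4 <= N ^+ 2 by nra.
by rewrite lef_pV2 ?posrE//; nra.
Qed.

Lemma remaining_mass_nonincreasing i j : (i <= j)%N -> remaining_mass j <= remaining_mass i.
Proof.
move=> ij; rewrite /remaining_mass lef_pV2 ?posrE ?exprn_gt0 ?ltr0n ?scale_gt0//.
by rewrite -!natrX ler_nat leq_exp2r// leq_scale.
Qed.

Lemma remaining_mass_le j : remaining_mass j <= 4^-1.
Proof.
have h := scaleR_ge2 j.
rewrite /remaining_mass lef_pV2 ?posrE ?exprn_gt0 ?ltr0n ?scale_gt0//; nra.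
Qed.

Lemma mass_ge0 j : 0 <= remaining_mass j - remaining_mass j.+1.
Proof. by rewrite subr_ge0 remaining_mass_nonincreasing. Qed.

Definition mass j : {nonneg R} := NngNum (mass_ge0 j).

Lemma massE j : (mass j)%:num = remaining_mass j - remaining_mass j.+1.
Proof. by []. Qed.

Lemma mass_le j : (mass j)%:num <= remaining_mass j.
Proof. by rewrite massE gerBl ltW// remaining_mass_gt0. Qed.

Lemma mass_ge j : 3 / 4 * remaining_mass j <= (mass j)%:num.
Proof. by rewrite massE; have := remaining_massS_le j; lra. Qed.

Lemma mass_gt0 j : 0 < (mass j)%:num.
Proof. by have := mass_ge j; have := remaining_mass_gt0 j; lra. Qed.

Lemma mass_le1 j : (mass j)%:num <= 1 :> R.
Proof. by have := mass_le j; have := remaining_mass_le j; lra. Qed.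

Lemma cvg_remaining_mass : remaining_mass j @[j --> \oo] --> 0.
Proof.
apply: (@squeeze_cvgr _ _ _ _ (fun=> 0) (@harmonic R)); [|exact: cvg_cst|exact: cvg_harmonic].
apply: nearW => j; rewrite ltW ?remaining_mass_gt0//=.
rewrite /remaining_mass lef_pV2 ?posrE ?exprn_gt0 ?ltr0n ?scale_gt0//.
have := scaleR_ge2 j; have : j.+1%:R <= (scale j)%:R :> R by rewrite ler_nat ltn_scale.
nra.
Qed.

Lemma mass_series m :
  (\sum_(m <= i <oo) (mass i)%:num%:E = (remaining_mass m)%:E)%E.
Proof.
apply/cvg_lim => //.
have : (remaining_mass m - remaining_mass n)%:E @[n --> \oo] --> (remaining_mass m - 0)%:E.
  by apply: cvg_EFin; [exact: nearW|apply: cvgB; [exact: cvg_cst|exact: cvg_remaining_mass]].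
rewrite subr0; apply: cvg_trans; apply: near_eq_cvg; near=> n.
rewrite sumEFin; congr (_%:E).
rewrite (@telescope_sumr_eq _ _ _ (fun j => - remaining_mass j)).
- by rewrite opprK addrC.
- by near: n; exact: nbhs_infty_ge.
- by move=> k _; rewrite opprK addrC.
Unshelve. all: by end_near. Qed.

Lemma decay_ge0 j x : 0 <= decay j x.
Proof. exact: expR_ge0. Qed.

Lemma decay_le1 j x : 0 <= x -> decay j x <= 1.
Proof. by move=> x0; rewrite /decay expR_le1 mulNr oppr_le0 mulr_ge0. Qed.

Lemma decay_le i j x : (i <= j)%N -> 0 <= x -> decay i x <= decay j x.
Proof.
move=> ij x0; rewrite ler_expR ler_wpM2r// lerN2 !rateE.
by rewrite lef_pV2 ?posrE ?ltr0n ?scale_gt0// ler_nat leq_scale.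
Qed.

Lemma two_le_expR1 : 2 <= expR 1 :> R.
Proof. by have := expR_ge1Dx (1 : R); lra. Qed.

(** Excess of two summands from the same component.  With [n], [N] consecutive
    scales and [a = log2 n]: for [x <= 8 n^3 / a] the factor [p_j x / n] is at
    most [8 / a]; beyond that point [N^2 <= exp (x / (4 n))], so that
    [exp (- x / n)] is far below the next component [N^-2 exp (- x / N)]. *)
Lemma diagonal_term_le j x : 0 <= x ->
  (mass j)%:num * ((rate j)%:num * x) * ((mass j)%:num * decay j x) <=
  8 / (log_scale j)%:R *
    ((mass j)%:num * decay j x + (mass j.+1)%:num * decay j.+1 x).
Proof.
move=> x0.
have n2 := scaleR_ge2 j; have nN := scaleRS_ge j.
have a1 : 1 <= (log_scale j)%:R :> R by rewrite ler1n log_scale_gt0.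
have aa : (log_scale j.+1)%:R * (log_scale j)%:R = (scale j)%:R ^+ 2 :> R.
  by rewrite -natrM -natrX log_scaleM.
have an : (log_scale j)%:R <= (scale j)%:R :> R.
  by rewrite ler_nat ltnW// ltn_expl.
have pn := mass_le j; have pN := mass_ge j.+1.
have p0 := mass_gt0 j.
have N2 : (scale j.+1)%:R ^+ 2 <= expR (2 * (log_scale j.+1)%:R) :> R.
  rewrite /scale natrX -exprM.
  have -> : 2 * (log_scale j.+1)%:R = (log_scale j.+1 * 2)%:R * 1 :> R by rewrite natrM; ring.
  rewrite expRM_natl; apply: lerXn2r; rewrite ?nnegrE ?expR_ge0//.
  exact: two_le_expR1.
have e0 := decay_ge0 j x; have eS0 := expR_gt0 (- (rate j.+1)%:num * x).
rewrite -/(decay j.+1 x) in eS0.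
have pS0 := mass_gt0 j.+1.
move: a1 aa an N2; set a := (log_scale j)%:R; set a' := (log_scale j.+1)%:R => a1 aa an N2.
move: (n2) (nN) an aa N2; set n := (scale j)%:R; set N := (scale j.+1)%:R => _ _ an aa N2.
have a0 : 0 < a by lra.
have n0 : 0 < n by rewrite ltr0n scale_gt0.
(* Past 8 n^3 / a, a fixed multiple of the crossing point, N^2 costs a quarter
   of the exponent and exp (x / N) at most half, which leaves a quarter to
   absorb the factor x. *)
have [xs|xl] := leP x (8 * n ^+ 3 / a).
  rewrite mulrDr -[leLHS]addr0 lerD//; last by rewrite !mulr_ge0// ?ltW// invr_gt0.
  rewrite ler_wpM2r ?mulr_ge0// rateE -/n.
  apply: (@le_trans _ _ (n ^- 2 * (n^-1 * (8 * n ^+ 3 / a)))).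
    have ni0 : 0 <= n^-1 by rewrite invr_ge0 ltW.
    by apply: ler_pM => //; [rewrite mulr_ge0 | exact: ler_wpM2l].
  by apply: eq_imp_le; field; rewrite !gt_eqF.
have N0 : 0 < N by rewrite ltr0n scale_gt0.
have Ne : N ^+ 2 <= expR (x / (4 * n)).
  apply: (le_trans N2); rewrite ler_expR.
  rewrite ler_pdivlMr ?mulr_gt0//.
  have -> : 2 * a' * (4 * n) = 8 * n ^+ 3 / a.
    have -> : a' = n ^+ 2 / a by rewrite -aa mulfK ?gt_eqF.
    by field; rewrite gt_eqF.
  exact: ltW.
have nN2 : 2 * n <= N by nra.
have xN : x / N <= x / (2 * n) by rewrite ler_wpM2l// lef_pV2 ?posrE ?mulr_gt0.
set y := x / (4 * n) in Ne.
have xE : x = 4 * n * y by rewrite /y; field; rewrite gt_eqF.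
have y0 : 0 <= y by rewrite divr_ge0// mulr_ge0// ltW.
have u : y * expR (- y) <= 1.
  by rewrite expRN ler_pdivrMr ?expR_gt0// mul1r; have := expR_ge1Dx y; lra.
have key : x * decay j x <= 4 * n * (N ^- 2 * decay j.+1 x).
  have -> : decay j x = expR (- y) * expR (- y) * expR (- (x / (2 * n))).
    rewrite /decay -!expRD rateE; congr expR; rewrite -/n /y; field; rewrite gt_eqF//.
  have d1 : expR (- (x / (2 * n))) <= decay j.+1 x.
    by rewrite /decay ler_expR rateE -/N mulNr lerN2 mulrC.
  have d2 : expR (- y) <= N ^- 2.
    by rewrite expRN lef_pV2 ?posrE ?expR_gt0 ?exprn_gt0.
  have -> : x * (expR (- y) * expR (- y) * expR (- (x / (2 * n)))) =
     4 * n * ((y * expR (- y)) * (expR (- y) * expR (- (x / (2 * n))))).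
    by rewrite {1}xE; ring.
  rewrite ler_wpM2l ?mulr_ge0 ?(ltW n0)//.
  rewrite -[leRHS]mul1r; apply: ler_pM => //; first exact: mulr_ge0.
  by apply: ler_pM => //; exact: expR_ge0.
rewrite mulrDr -[leLHS]add0r lerD ?mulr_ge0 ?invr_ge0 ?(ltW a0)//.
apply: (@le_trans _ _ (4 * n ^- 4 * (N ^- 2 * decay j.+1 x))).
  have -> : (mass j)%:num * ((rate j)%:num * x) * ((mass j)%:num * decay j x) =
      (mass j)%:num * (mass j)%:num * n^-1 * (x * decay j x).
    by rewrite rateE -/n; ring.
  have -> : 4 * n ^- 4 * (N ^- 2 * decay j.+1 x) =
      n ^- 2 * n ^- 2 * n^-1 * (4 * n * (N ^- 2 * decay j.+1 x)).
    by field; rewrite !gt_eqF.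
  apply: ler_pM => //; rewrite ?mulr_ge0 ?invr_ge0 ?(ltW n0)//.
  by rewrite ler_wpM2r ?invr_ge0 ?(ltW n0)//; apply: ler_pM.
have -> : 8 / a * ((mass j.+1)%:num * decay j.+1 x) =
   8 / a * (mass j.+1)%:num * decay j.+1 x by ring.
rewrite mulrA ler_wpM2r ?decay_ge0//.
have na : n ^- 4 <= a^-1.
  rewrite lef_pV2 ?posrE ?exprn_gt0//; apply: (le_trans an).
  by rewrite ler_eXnr//; lra.
have Ni : 0 < N ^- 2 by rewrite invr_gt0 exprn_gt0.
have ai : 0 < a^-1 by rewrite invr_gt0.
apply: (@le_trans _ _ (4 * a^-1 * N ^- 2)).
  by rewrite ler_wpM2r ?(ltW Ni)// ler_wpM2l.
rewrite /remaining_mass -/N in pN.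
have : 4 * a^-1 * N ^- 2 <= 8 * a^-1 * (3 / 4 * N ^- 2).
  by have : 0 <= a^-1 * N ^- 2 by [rewrite mulr_ge0// ltW]; lra.
by move/le_trans; apply; rewrite ler_wpM2l// mulr_ge0// ltW.
Qed.

End weights.

Arguments rate : simpl never.
Arguments mass : simpl never.

(** * The positive part is subexponential *)

Section hyperexponential.
Context {R : realType}.
Implicit Types (x : R) (i j m : nat).

Local Notation e := (@decay R).
Local Notation a j := ((log_scale j)%:R : R).

(** Here [r_i / (r_i - r_j) = n_j / (n_j - n_i)], which [scale_gap] controls. *)
Lemma exponential_pair_gt i j x : (i < j)%N ->
  expR (- (rate j)%:num * x) * ((rate i)%:num / ((rate i)%:num - (rate j)%:num)) <=
  (1 + 2 / a j) * e j x.
Proof.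
move=> ij; rewrite mulrC ler_wpM2r ?expR_ge0// !rateE.
have : (scale i)%:R * (a j + 2) <= 2 * (scale j)%:R :> R.
  by rewrite -!(natrM, natrD) ler_nat scale_gap.
have a1 : 1 <= a j by rewrite ler1n log_scale_gt0.
have : 0 < (scale i)%:R :> R by rewrite ltr0n scale_gt0.
have : 0 < (scale j)%:R :> R by rewrite ltr0n scale_gt0.
move: a1; set a := a j; move: (scale i)%:R (scale j)%:R => n N a1 N0 n0 gap.
have nN : n < N by nra.
have -> : n^-1 / (n^-1 - N^-1) = N / (N - n).
  by field; rewrite !gt_eqF ?subr_gt0.
have -> : 1 + 2 / a = (a + 2) / a by field; rewrite gt_eqF//; lra.
by rewrite ler_pdivrMr ?subr_gt0// mulrAC ler_pdivlMr; nra.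
Qed.

(** The bound is symmetric in [i] and [j], so that the double sum over the
    mixture splits into single sums without being reordered; the price is the
    superfluous term of the faster rate. *)
Lemma exponential_pair_le i j x : 0 <= x ->
  tail (convolution (expo (rate i)) (expo (rate j))) x <=
  (1 + 2 / a i) * e i x + (1 + 2 / a j) * e j x +
  (if j == i then (rate i)%:num * x * e i x else 0).
Proof.
move=> x0.
have nn k : 0 <= (1 + 2 / a k) * e k x.
  by rewrite mulr_ge0 ?decay_ge0// addr_ge0// divr_ge0.
have rate_lt k k' : (k < k')%N -> (rate k')%:num < (rate k)%:num :> R.
  move=> kk; rewrite !rateE ltf_pV2 ?posrE ?ltr0n ?scale_gt0// ltr_nat.
  have := scale_gap kk; have := scale_gt0 k; have := scale_gt0 k'; have := log_scale_gt0 k'.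
  nia.
case: ltngtP => [ji|ij|->].
- rewrite addr0 -[leLHS]addr0; apply: lerD => //.
  exact: le_trans (convolution_expo_ltr _ (rate_lt _ _ ji)) (exponential_pair_gt _ ji).
- rewrite addr0 -[leLHS]add0r; apply: lerD => //.
  exact: le_trans (convolution_expo_ltl _ (rate_lt _ _ ij)) (exponential_pair_gt _ ij).
- apply: (le_trans (convolution_expo_diag _ x0)).
  rewrite -/(e i x) mulrDr mulr1 lerD//; last by rewrite mulrC.
  have e0 := decay_ge0 i x.
  have : 0 <= 2 / a i by rewrite divr_ge0.
  nra.
Qed.

Lemma hyper_weight_ge0 j : 0 <= (remaining_mass 0)^-1 * (mass j)%:num :> R.
Proof. by rewrite mulr_ge0// invr_ge0 ltW// remaining_mass_gt0. Qed.

(** The component weights of [F], conditioned to be positive. *)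
Definition hyper_weight j : {nonneg R} := NngNum (hyper_weight_ge0 j).

Lemma hyper_weight1 : (\sum_(i <oo) (hyper_weight i)%:num%:E = 1 :> \bar R)%E.
Proof.
rewrite series_EFinZ// mass_series -EFinM mulVf// gt_eqF// remaining_mass_gt0//.
Qed.

Definition hyperexponential : distr R :=
  mixture hyper_weight (fun j => expo (rate j)).

Local Notation G := hyperexponential.
Local Notation q j := ((hyper_weight j)%:num).
Local Notation t0 := (@remaining_mass R 0).

Lemma hyper_tail x : 0 <= x ->
  ((tail G x)%:E = \sum_(i <oo) (q i * e i x)%:E)%E.
Proof.
move=> x0; rewrite mixture_tail; last exact: hyper_weight1.
by apply: eq_eseriesr => i _; rewrite tail_expo max_r.
Qed.

Lemma hyper_tail_ge_term j x : 0 <= x -> q j * e j x <= tail G x.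
Proof.
move=> x0; rewrite -lee_fin hyper_tail//.
apply: (@series_ge_term _ (fun i => q i * e i x)) => i.
by rewrite mulr_ge0 ?decay_ge0.
Qed.

(** Error terms carry a factor [1 / a_i].  Components up to [m] are bounded by
    the slowest of them, later ones gain [1 / a_m].  The diagonal excess of
    component [i] also involves component [i+1], hence the second index. *)
Lemma inv_log_scale_decay_le m i k x : (k <= i.+1)%N -> 0 <= x ->
  (a i)^-1 * e k x <= e m x + (a m)^-1 * e k x.
Proof.
move=> ki x0; have ai l : 0 < a l by rewrite ltr0n log_scale_gt0.
have [km|mk] := leqP k m.
  have : (a i)^-1 * e k x <= e m x.
    rewrite -[leRHS]mul1r; apply: ler_pM; rewrite ?invr_ge0 ?decay_ge0//.
      by rewrite invf_le1// ler1n log_scale_gt0.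
    exact: decay_le.
  have : 0 <= (a m)^-1 * e k x by rewrite mulr_ge0 ?decay_ge0 ?invr_ge0.
  lra.
have : (a i)^-1 * e k x <= (a m)^-1 * e k x.
  rewrite ler_wpM2r ?decay_ge0// lef_pV2 ?posrE// ler_nat.
  by apply: leq_log_scale; rewrite -ltnS (leq_trans mk).
have := decay_ge0 m x; lra.
Qed.

(** The parameter [m] is free: [e m x] is negligible against [tail G x] as [x]
    grows, and [1 / a_m] is small for large [m]. *)
Lemma hyper_convolution_le m x : 0 <= x ->
  tail (convolution G G) x <=
  2 * tail G x + (4 + 16 / t0) * (e m x + (a m)^-1 * tail G x).
Proof.
move=> x0; rewrite -lee_fin mixture_convolution_tail; last exact: hyper_weight1.
have t00 : 0 < t0 by exact: remaining_mass_gt0.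
have am : 0 <= (a m)^-1 by rewrite invr_ge0.
pose A i := e i x + 2 * (e m x + (a m)^-1 * e i x).
pose B i := (rate i)%:num * x * e i x.
pose s := tail G x + 2 * (e m x + (a m)^-1 * tail G x).
have qe0 i : 0 <= q i * e i x by rewrite mulr_ge0 ?decay_ge0.
have A0 i : 0 <= A i.
  by rewrite !addr_ge0 ?mulr_ge0 ?addr_ge0 ?mulr_ge0 ?decay_ge0.
have B0 i : 0 <= B i by rewrite !mulr_ge0 ?decay_ge0.
have s0 : 0 <= s.
  by rewrite !addr_ge0 ?mulr_ge0 ?addr_ge0 ?mulr_ge0 ?decay_ge0 ?tail_ge0.
have qA : (\sum_(i <oo) (q i * A i)%:E = s%:E)%E.
  transitivity (\sum_(i <oo) ((1 + 2 * (a m)^-1) * (q i * e i x) + 2 * e m x * q i)%:E)%E.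
    by apply: eq_eseriesr => i _; congr (_%:E); rewrite /A; ring.
  have c0 : 0 <= 1 + 2 * (a m)^-1 by rewrite addr_ge0// mulr_ge0.
  rewrite series_EFinD; last 2 first.
  - by move=> i; apply: mulr_ge0.
  - by move=> i; apply: mulr_ge0 => //; rewrite mulr_ge0 ?decay_ge0.
  rewrite (@series_EFinZ _ _ (fun i => q i * e i x))//.
  rewrite series_EFinZ// hyper_weight1 -hyper_tail// mule1 -EFinM -EFinD.
  by congr (_%:E); rewrite /s; ring.
have inner i : (\sum_(j <oo) (q j * tail (convolution (expo (rate i)) (expo (rate j))) x)%:E
    <= (A i + s + q i * B i)%:E)%E.
  apply: (@le_trans _ _ (\sum_(j <oo) (A i * q j + q j * A j +
      (if j == i then q i * B i else 0))%:E)%E).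
    apply: series_EFin_le => j; first by rewrite mulr_ge0 ?tail_ge0.
    have h := exponential_pair_le i j x0.
    have hi := inv_log_scale_decay_le m (leqnSn i) x0.
    have hj := inv_log_scale_decay_le m (leqnSn j) x0.
    have -> : A i * q j + q j * A j + (if j == i then q i * B i else 0) =
              q j * (A i + A j + (if j == i then B i else 0)).
      by case: eqP => [->|_]; ring.
    rewrite ler_wpM2l//; apply: (le_trans h); rewrite lerD// /A.
    have -> k : (1 + 2 / a k) * e k x = e k x + 2 * ((a k)^-1 * e k x) by ring.
    by lra.
  rewrite series_EFinD; last 2 first.
  - by move=> j; apply: addr_ge0; apply: mulr_ge0.
  - by move=> j; case: ifP => // _; exact: mulr_ge0.
  rewrite series_EFinD; [|by move=> j; exact: mulr_ge0..].
  rewrite series_EFinZ// hyper_weight1 mule1 qA series_single; last exact: mulr_ge0.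
  exact: lexx.
apply: (@le_trans _ _ (\sum_(i <oo) (q i * A i + s * q i + q i * (q i * B i))%:E)%E).
  apply: lee_nneseries => i _ *.
    rewrite mule_ge0 ?lee_fin// nneseries_ge0// => j _ _.
    by rewrite lee_fin mulr_ge0 ?tail_ge0.
  apply: (@le_trans _ _ ((q i)%:E * (A i + s + q i * B i)%:E)%E).
    by rewrite lee_wpmul2l ?lee_fin.
  by rewrite -EFinM lee_fin; apply: eq_imp_le; ring.
rewrite series_EFinD; last 2 first.
- by move=> i; apply: addr_ge0; apply: mulr_ge0.
- by move=> i; apply: mulr_ge0 => //; exact: mulr_ge0.
rewrite series_EFinD; [|by move=> i; exact: mulr_ge0..].
rewrite qA series_EFinZ// hyper_weight1 mule1.
have diag : (\sum_(i <oo) (q i * (q i * B i))%:E <=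
    (16 / t0 * (e m x + (a m)^-1 * tail G x))%:E)%E.
  pose D i := e m x * q i + (a m)^-1 * (q i * e i x).
  have D0 i : 0 <= D i by apply: addr_ge0; apply: mulr_ge0 => //; exact: decay_ge0.
  have sumD : (\sum_(i <oo) (D i)%:E = (e m x + (a m)^-1 * tail G x)%:E)%E.
    rewrite series_EFinD; last 2 first.
    - by move=> i; apply: mulr_ge0 => //; exact: decay_ge0.
    - by move=> i; exact: mulr_ge0.
    rewrite series_EFinZ// hyper_weight1 mule1.
    by rewrite (@series_EFinZ _ _ (fun i => q i * e i x))// -hyper_tail// -EFinM -EFinD.
  apply: (@le_trans _ _ (\sum_(i <oo) (8 / t0 * (D i + D i.+1))%:E)%E).
    apply: series_EFin_le => i; first by apply: mulr_ge0 => //; exact: mulr_ge0.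
    have diag := @diagonal_term_le R i x x0.
    have -> : q i * (q i * B i) =
      t0^-1 * (t0^-1 * ((mass i)%:num * ((rate i)%:num * x) * ((mass i)%:num * decay i x))).
      by rewrite /B /=; ring.
    have -> : 8 / t0 * (D i + D i.+1) = t0^-1 * (8 * (D i + D i.+1)) by ring.
    have ti : 0 <= t0^-1 by rewrite invr_ge0 ltW.
    apply: ler_wpM2l => //; apply: (le_trans (ler_wpM2l ti diag)).
    have -> : t0^-1 * (8 / a i * ((mass i)%:num * e i x + (mass i.+1)%:num * e i.+1 x)) =
        8 * (q i * ((a i)^-1 * e i x) + q i.+1 * ((a i)^-1 * e i.+1 x)).
      by rewrite /=; ring.
    apply: ler_wpM2l => //; apply: lerD.
      have -> : D i = q i * (e m x + (a m)^-1 * e i x) by rewrite /D; ring.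
      by apply: ler_wpM2l => //; exact: inv_log_scale_decay_le.
    have -> : D i.+1 = q i.+1 * (e m x + (a m)^-1 * e i.+1 x) by rewrite /D; ring.
    by apply: ler_wpM2l => //; exact: inv_log_scale_decay_le.
  have t8 : 0 <= 8 / t0 by rewrite divr_ge0 ?ltW.
  rewrite series_EFinZ; last by move=> i; exact: addr_ge0.
  rewrite series_EFinD//.
  apply: (@le_trans _ _ ((8 / t0)%:E * (\sum_(i <oo) (D i)%:E + \sum_(i <oo) (D i)%:E))%E).
    by rewrite lee_wpmul2l ?lee_fin// leeD2l// series_shift_le.
  by rewrite sumD -EFinD -EFinM lee_fin; apply: eq_imp_le; ring.
apply: (le_trans (leeD2l _ diag)).
by rewrite -!EFinD lee_fin; apply: eq_imp_le; rewrite /s; ring.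
Qed.

End hyperexponential.

Section distribution_facts.
Context {R : realType}.
Implicit Types (P : distr R) (x y : R).

Lemma Rplus_mass1 P : tail P 0 = 1 -> P (@Rplus R) = 1%E.
Proof.
move=> P0; apply/eqP; rewrite eq_le probability_le1/=; last exact: measurable_Rplus.
have <- : P `]0, +oo[%classic = 1%E by rewrite tailE P0.
apply: le_measure; rewrite ?inE//; first exact: measurable_Rplus.
by apply: subset_itvr; rewrite bnd_simp.
Qed.

Let id_real : R -> R := idfun.

#[local] HB.instance Definition _ :=
  @isMeasurableFun.Build _ _ _ _ id_real (@measurable_id _ _ setT).

Lemma cvg_tail P : tail P x @[x --> +oo] --> 0.
Proof. exact: (fine_cvg (cvg_ccdfy0 (id_real : {RV P >-> R}))). Qed.

Lemma interval_mass P x y : x <= y -> P `]x, y]%classic = (tail P x - tail P y)%:E.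
Proof.
move=> xy.
have : (P `]x, +oo[%classic = P `]x, y]%classic + P `]y, +oo[%classic)%E.
  rewrite -measureU//; last first.
    by apply/seteqP; split=> z //= []; rewrite !in_itv/= => /andP[_ ?]; lra.
  by rewrite -itv_bndbnd_setU ?bnd_simp.
by rewrite !tailE EFinB => ->; rewrite addeK.
Qed.

Lemma msupport_of_tail P x : (forall y, x < y -> tail P y < tail P x) -> msupport P x.
Proof.
move=> Px U oU Ux; have : nbhs x U by exact: open_nbhs_nbhs.
move=> /nbhs_ballP[r /= r0 rU].
have xr : x < x + r / 2 by rewrite ltrDl divr_gt0.
apply: (@lt_le_trans _ _ (P `]x, x + r / 2]%classic)).
  by rewrite interval_mass ?(ltW xr)// lte_fin subr_gt0 Px.
apply: le_measure; rewrite ?inE//; first exact: open_measurable.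
move=> z /=; rewrite in_itv/= => /andP[xz zr]; apply: rU.
by rewrite /ball/= ltr_norml; lra.
Qed.

End distribution_facts.

Section hyperexponential_subexponential.
Context {R : realType}.
Implicit Types (x : R) (m : nat).

Local Notation e := (@decay R).
Local Notation a j := ((log_scale j)%:R : R).
Local Notation G := (@hyperexponential R).
Local Notation q j := ((hyper_weight j)%:num : R).
Local Notation t0 := (@remaining_mass R 0).

Lemma hyper_weight_gt0 j : 0 < q j.
Proof. by rewrite /= mulr_gt0 ?mass_gt0// invr_gt0 remaining_mass_gt0. Qed.

Lemma hyper_tail_gt0 x : 0 <= x -> 0 < tail G x.
Proof.
move=> x0; apply: lt_le_trans (hyper_tail_ge_term 0 x0).
by rewrite mulr_gt0 ?hyper_weight_gt0 ?expR_gt0.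
Qed.

Lemma hyper_Rplus : G (@Rplus R) = 1%E.
Proof.
apply: Rplus_mass1; apply: EFin_inj; rewrite hyper_tail// -[RHS]hyper_weight1.
by apply: eq_eseriesr => i _; rewrite /decay mulr0 expR0 mulr1.
Qed.

Lemma hyper_tail_decreasing x y : 0 <= x -> x < y -> tail G y < tail G x.
Proof.
move=> x0 xy; have y0 : 0 <= y by lra.
rewrite -subr_gt0 -lte_fin -interval_mass ?ltW//.
rewrite mixtureE; last exact: hyper_weight1.
pose f i := q i * (e i x - e i y).
have f0 i : 0 <= f i.
  by rewrite mulr_ge0// subr_ge0 ler_expR ler_wnM2l ?oppr_le0// ltW.
rewrite (eq_eseriesr (g := fun i => (f i)%:E)); last first.
  move=> i _; rewrite EFinM [X in (_ * X)%E = _]interval_mass ?ltW//.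
  by rewrite !tail_expo !max_r.
apply: lt_le_trans (series_ge_term 0 f0).
rewrite lte_fin mulr_gt0 ?hyper_weight_gt0// subr_gt0 ltr_expR.
by rewrite ltr_nM2l// oppr_lt0.
Qed.

Lemma hyper_support_unbounded : ~ bounded_set (msupport G).
Proof.
move=> [M [_ MP]]; pose z := Num.max 0 M + 1.
have z1 : 1 <= z by rewrite lerDr le_max lexx.
have Mz : M < z by rewrite ltr_pwDr// le_max lexx orbT.
have := MP z Mz (z + 1); rewrite /= ger0_norm; last lra.
have Gz : msupport G (z + 1).
  by apply: msupport_of_tail => y; apply: hyper_tail_decreasing; lra.
by move=> /(_ Gz); lra.
Qed.

(** Comparing [e m x] with the single term [m.+1] of [tail G x] shows that
    their ratio decays exponentially. *)
Lemma hyper_ratio_le m x : 0 <= x ->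
  tail (convolution G G) x / tail G x <=
  2 + (4 + 16 / t0) * ((q m.+1)^-1 * expR (- ((rate m)%:num - (rate m.+1)%:num) * x)
     + (a m)^-1).
Proof.
move=> x0; have G0 := hyper_tail_gt0 x0.
rewrite ler_pdivrMr// (le_trans (hyper_convolution_le m x0))//.
have K0 : 0 <= 4 + 16 / t0 by rewrite addr_ge0// divr_ge0// ltW// remaining_mass_gt0.
rewrite [leRHS]mulrDl lerD2l -[leRHS]mulrA ler_wpM2l// [leRHS]mulrDl lerD2r.
have -> : e m x = (q m.+1)^-1 * expR (- ((rate m)%:num - (rate m.+1)%:num) * x)
     * (q m.+1 * e m.+1 x).
  rewrite mulrACA mulVf ?mul1r ?gt_eqF ?hyper_weight_gt0//.
  by rewrite /decay -expRD; congr expR; ring.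
by rewrite ler_wpM2l ?hyper_tail_ge_term// mulr_ge0 ?expR_ge0.
Qed.

Lemma hyper_convolution_cvg :
  tail (convolution G G) x / tail G x @[x --> +oo] --> (2 : R).
Proof.
apply/cvgrPdist_le => eps eps0.
pose K := 4 + 16 / t0.
have K0 : 0 < K by rewrite addr_gt0// divr_gt0// remaining_mass_gt0.
have [m mK] : exists m : nat, K * 2 / eps < m%:R.
  by exists (Num.bound (K * 2 / eps)); rewrite archi_boundP// divr_ge0 ?mulr_ge0 ?ltW.
have am : K * (a m)^-1 <= eps / 2.
  have := ltn_log_scale m; rewrite -(ltr_nat R) => ma.
  rewrite ler_pdivrMr; last by rewrite ltr0n log_scale_gt0.
  by move: mK; rewrite ltr_pdivrMr//; nra.
pose d := (rate m)%:num - (rate m.+1)%:num : R.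
have d0 : 0 < d.
  rewrite subr_gt0 !rateE ltf_pV2 ?posrE ?ltr0n ?scale_gt0//.
  have := @scaleRS_ge R m; have := @scaleR_ge2 R m; nra.
have q0 := hyper_weight_gt0 m.+1.
near=> x.
have x0 : 0 <= x by near: x; exact: nbhs_pinfty_ge.
have xbig : 2 * K / (q m.+1 * d * eps) <= x.
  by near: x; apply: nbhs_pinfty_ge; exact: num_real.
have Geps : tail G x <= eps.
  have : `|0 - tail G x| <= eps by near: x; move/cvgrPdist_le : (cvg_tail G); exact.
  by rewrite sub0r normrN ger0_norm// tail_ge0.
have G0 := hyper_tail_gt0 x0.
rewrite ler_distl; apply/andP; split; last first.
  have := tail_convolution_ge hyper_Rplus x0.
  rewrite -lerBlDr ler_pdivlMr//; nra.
rewrite lerBlDr; apply: (le_trans (hyper_ratio_le m x0)).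
rewrite -/K -/d lerD2l mulrDr [leRHS]splitr lerD//.
have Ex : expR (- d * x) * (d * x) <= 1.
  rewrite mulNr expRN mulrC ler_pdivrMr ?expR_gt0// mul1r.
  by have := expR_ge1Dx (d * x); lra.
have xb : 2 * K <= x * (q m.+1 * d * eps).
  have dn : 0 < q m.+1 * d * eps by apply: mulr_gt0 => //; exact: mulr_gt0.
  by move: xbig; rewrite ler_pdivrMr.
have E0 := expR_ge0 (- d * x).
rewrite mulrCA mulrC ler_pdivrMr//.
have : expR (- d * x) * (2 * K) <= expR (- d * x) * (d * x) * (q m.+1 * eps).
  by rewrite -mulrA ler_wpM2l// -[leRHS]mulrA; lra.
have : expR (- d * x) * (d * x) * (q m.+1 * eps) <= 1 * (q m.+1 * eps).
  by rewrite ler_wpM2r// mulr_ge0// ltW.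
lra.
Unshelve. all: by end_near. Qed.

Lemma hyper_subexponential : subexponential_nneg G.
Proof.
split; [exact: hyper_Rplus|exact: hyper_support_unbounded|exact: hyper_convolution_cvg].
Qed.

End hyperexponential_subexponential.

(** * The step law: subexponential with negative mean *)

Lemma mass1_setI {R : realType} (P : distr R) (A B : set R) :
  measurable A -> measurable B -> P B = 1%E -> P (A `&` B) = P A.
Proof.
move=> mA mB PB; apply/eqP; rewrite eq_le; apply/andP; split.
  by apply: le_measure; rewrite ?inE//; exact: measurableI.
have PBC : P (~` B) = 0%E by rewrite probability_setC// PB subee.
have -> : P A = (P (A `&` B) + P (A `\` B))%E.
  rewrite -measureU ?setUIDK//; [exact: measurableI|exact: measurableD|].
  by rewrite setDE setIACA setICr setI0.
rewrite -[leRHS]adde0 leeD2l// -PBC; apply: le_measure; rewrite ?inE//.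
  exact: measurableD.
exact: measurableC.
Qed.

Lemma subexponential_nneg_eq {R : realType} (P Q : distr R) :
  (forall A, measurable A -> P A = Q A) ->
  subexponential_nneg Q -> subexponential_nneg P.
Proof.
move=> PQ [Q1 Qsupp Qcvg].
have tPQ x : tail P x = tail Q x by rewrite /tail PQ.
have sPQ : msupport P = msupport Q.
  by apply/seteqP; split=> x Px U oU Ux; have := Px U oU Ux;
    rewrite PQ//; exact: open_measurable.
split; [rewrite PQ//; exact: measurable_Rplus|by rewrite sPQ|].
apply: cvg_trans Qcvg; apply: near_eq_cvg; near=> x.
rewrite tPQ; congr (_ / _); apply: EFin_inj.
rewrite !convolution_tailr (@eq_measure_integral _ _ _ _ Q P); last first.
  by move=> A mA _; exact: PQ.
by apply: eq_integral => y _; rewrite tPQ.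
Unshelve. all: by end_near. Qed.

Section step_law.
Context {R : realType}.
Implicit Types (x : R) (j : nat).

Local Notation e := (@decay R).
Local Notation G := (@hyperexponential R).
Local Notation t0 := (@remaining_mass R 0).

(** Any atom at [- drift] with [3/4 * drift > 8] gives a negative mean: see
    [sum_absolute_means_le]. *)
Definition drift : R := 16.

Lemma step_weight_ge0 j : 0 <= (if j is i.+1 then (mass i)%:num else 1 - t0).
Proof. by case: j => [|j//]; have := @remaining_mass_le R 0; lra. Qed.

Definition step_weight j : {nonneg R} := NngNum (step_weight_ge0 j).

Definition step_component j : distr R :=
  if j is i.+1 then expo (rate i) else dirac (- drift).

Lemma step_weight1 : (\sum_(i <oo) (step_weight i)%:num%:E = 1 :> \bar R)%E.
Proof.
rewrite series_recl; last by move=> i; rewrite lee_fin.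
by rewrite /= mass_series -EFinD subrK.
Qed.

Definition step_law : distr R := mixture step_weight step_component.

Local Notation F := step_law.

Lemma step_lawE A :
  F A = ((1 - t0)%:E * \d_(- drift)%R A + t0%:E * G A)%E.
Proof.
rewrite mixtureE; last exact: step_weight1.
rewrite series_recl; last by move=> i; rewrite mule_ge0// lee_fin.
congr (_ + _)%E; rewrite mixtureE; last exact: hyper_weight1.
rewrite -nneseriesZl; last by move=> i _; rewrite mule_ge0// lee_fin.
apply: eq_eseriesr => i _; rewrite muleA -EFinM /= mulrA mulfV ?mul1r//.
by rewrite gt_eqF// remaining_mass_gt0.
Qed.

Lemma ge0_integral_step_law (f : R -> R) :
  measurable_fun setT f -> (forall x, 0 <= f x) ->
  (\int[F]_x (f x)%:E = ((1 - t0) * f (- drift)%R)%:E +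
    \sum_(i <oo) (mass i)%:num%:E * \int[expo (rate i)]_x (f x)%:E)%E.
Proof.
move=> mf f0.
have fE0 x : (0 <= (f x)%:E)%E by rewrite lee_fin.
have mfE : measurable_fun setT (EFin \o f) by exact/measurable_EFinP.
rewrite ge0_integral_mixture//; last exact: step_weight1.
rewrite series_recl; last first.
  by move=> i; apply: mule_ge0; [rewrite lee_fin|apply: integral_ge0 => x _].
congr (_ + _)%E.
by rewrite /= integral_dirac// diracT mul1e -EFinM.
Qed.

Lemma step_law_Rplus A : measurable A -> F (A `&` @Rplus R) = (t0%:E * G A)%E.
Proof.
move=> mA; rewrite step_lawE (mass1_setI (P := G) mA (@measurable_Rplus R) hyper_Rplus).
rewrite /= diracE memNset ?mule0 ?add0e// => -[_].
by rewrite /Rplus/= in_itv/= /drift; lra.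
Qed.

Lemma tail_step_law x : 0 <= x -> tail F x = t0 * tail G x.
Proof.
move=> x0; apply: EFin_inj; rewrite EFinM -!tailE -step_law_Rplus//.
congr (F _); rewrite setIidl// => y; rewrite /Rplus/= !in_itv/=; lra.
Qed.

Lemma step_law_subexponential : subexponential F.
Proof.
have F0 : F (@Rplus R) = t0%:E.
  by rewrite -[X in F X]setTI step_law_Rplus// probability_setT mule1.
have t00 : 0 < t0 by exact: remaining_mass_gt0.
split; first by rewrite F0 lte_fin.
apply: subexponential_nneg_eq hyper_subexponential => A mA.
rewrite /cond_Rplus /= /mnormalize /= /mrestr setTI F0 /=.
rewrite eqe gt_eqF//= step_law_Rplus// muleAC -EFinM mulfV ?mul1e//.
by rewrite gt_eqF.
Qed.

(** From [x <= (2 / l) exp (l x / 2)] and the moment generating function; the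
    constant 4 instead of 1 is harmless. *)
Lemma expo_mean_le (l : {posnum R}) :
  (\int[expo l]_x `|x|%:E <= (4 / l%:num)%:E)%E.
Proof.
have mE : measurable_fun setT (fun x : R => expR (l%:num / 2 * x)) by exact: measurable_expRM.
apply: (@le_trans _ _ (\int[expo l]_x (2 / l%:num * expR (l%:num / 2 * x))%:E)%E).
  apply: ge0_integral_expo_le => //.
  - exact: measurable_funM.
  move=> x x0; rewrite ger0_norm// mulrAC ler_pdivlMr//.
  by have := expR_ge1Dx (l%:num / 2 * x); lra.
under eq_integral do rewrite EFinM.
rewrite ge0_integralZl//=; last exact/measurable_EFinP.
have l0 : 0 < l%:num by [].
rewrite expo_mgf -?EFinM ?lee_fin; last lra.
by apply: eq_imp_le; field; rewrite !gt_eqF//; lra.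
Qed.

(** Dominated by a telescoping sum, as [1 / n_k <= 2 / n_k - 2 / n_{k+1}]. *)
Lemma mass_scale_sum k : \sum_(i < k) (mass i)%:num * (scale i)%:R <= 2 - 2 / (scale k)%:R :> R.
Proof.
elim: k => [|k ih].
  by rewrite big_ord0 subr_ge0 ler_pdivrMr ?ltr0n ?scale_gt0//; have := @scaleR_ge2 R 0; lra.
rewrite big_ord_recr/=; have := @mass_le R k; have := @scaleR_ge2 R k; have := @scaleRS_ge R k.
move: ih; rewrite massE /remaining_mass.
move: (scale k)%:R (scale k.+1)%:R (\sum_(i < k) _) => n N S ih nN n2 pn.
have n0 : 0 < n by lra.
have N0 : 0 < N by nra.
have h1 : (n ^- 2 - N ^- 2) * n <= n^-1.
  by apply: (le_trans (ler_wpM2r (ltW n0) pn)); rewrite exprSr invfM mulfVK// gt_eqF.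
have h2 : 2 / N <= n^-1.
  by rewrite ler_pdivrMr// mulrC ler_pdivlMr//; nra.
lra.
Qed.

Lemma sum_absolute_means_le : (\sum_(i <oo) (mass i)%:num%:E *
  \int[expo (rate i)]_x `|x|%:E <= 8%:E :> \bar R)%E.
Proof.
apply: (@le_trans _ _ (\sum_(i <oo) (4 * ((mass i)%:num * (scale i)%:R))%:E)%E).
  apply: lee_nneseries => [i _ _|i _].
    by apply: mule_ge0; [rewrite lee_fin|apply: integral_ge0 => x _; rewrite lee_fin].
  apply: (le_trans (lee_wpmul2l _ (expo_mean_le _))); first by rewrite lee_fin.
  by rewrite -EFinM lee_fin rateE invrK mulrCA.
apply: lime_le.
  by apply: is_cvg_nneseries => i _ _; rewrite lee_fin !mulr_ge0.
apply: nearW => k; rewrite sumEFin lee_fin big_mkord -mulr_sumr.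
have := mass_scale_sum k.
have : 0 <= 2 / (scale k)%:R :> R by rewrite divr_ge0.
lra.
Qed.

Lemma step_law_integrable : F.-integrable [set: R] (fun t : R => t%:E).
Proof.
apply/integrableP; split; first exact/measurable_EFinP.
under eq_integral do rewrite /=.
rewrite ge0_integral_step_law//.
apply: le_lt_trans (leeD2l _ sum_absolute_means_le) _.
by rewrite -EFinD ltry.
Qed.

Lemma step_law_mean_lt0 : ('E_F[fun t : R => t] < 0)%E.
Proof.
rewrite unlock integralE.
have mmax (s : R) : measurable_fun setT (fun x : R => Num.max (s * x) 0).
  by apply: measurable_maxr => //; exact: mulrl_measurable.
have max0 (s x : R) : 0 <= Num.max (s * x) 0 by rewrite le_max lexx orbT.
have t4 := @remaining_mass_le R 0.
have pos : (\int[F]_x (fun t : R => t%:E)^\+ x <= 8%:E)%E.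
  rewrite (eq_integral (fun x => (Num.max (1 * x) 0)%:E)); last first.
    by move=> x _; rewrite funeposE mul1r EFin_max.
  rewrite ge0_integral_step_law//.
  have -> : Num.max (1 * - drift) 0 = 0 :> R by rewrite max_r// /drift; lra.
  rewrite mulr0 add0e; apply: le_trans sum_absolute_means_le.
  apply: lee_nneseries => [i _ _|i _].
    by apply: mule_ge0; [rewrite lee_fin|apply: integral_ge0 => x _; rewrite lee_fin].
  rewrite lee_wpmul2l ?lee_fin//; apply: ge0_integral_expo_le => //.
  by move=> x x0; rewrite mul1r ger0_norm// max_l.
have neg : (12%:E <= \int[F]_x (fun t : R => t%:E)^\- x)%E.
  rewrite (eq_integral (fun x => (Num.max ((-1) * x) 0)%:E)); last first.
    by move=> x _; rewrite funenegE mulN1r EFin_max.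
  rewrite ge0_integral_step_law//.
  have -> : Num.max ((-1) * - drift) 0 = 16 :> R by rewrite mulrNN mul1r max_l.
  apply: (@le_trans _ _ ((1 - t0) * 16)%:E); first by rewrite lee_fin; lra.
  rewrite leeDl// nneseries_ge0// => i _ _.
  by apply: mule_ge0; [rewrite lee_fin|apply: integral_ge0 => x _; rewrite lee_fin].
apply: (le_lt_trans (leeB pos neg)).
by rewrite -EFinB lte_fin; lra.
Qed.

End step_law.

(** * Two jumps in a sum of steps *)

Section sums_of_steps.
Context {R : realType}.
Implicit Types (x y z : R) (j n : nat).

Local Notation F := (@step_law R).
Local Notation A := (@drift R).
Local Notation t0 := (@remaining_mass R 0).

Lemma ge_integral_expo (f : R -> R) i :
  {homo f : x y / x <= y} -> (forall x, 0 <= f x) ->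
  ((f (- A))%:E <= \int[expo (rate i)]_x (f x)%:E)%E.
Proof.
move=> fnd f0; apply: (@le_trans _ _ (\int[expo (rate i)]_x (f (- A))%:E)%E).
  by rewrite integral_cst// [X in (_ * X)%E]probability_setT mule1.
apply: ge0_integral_expo_le => //; first exact: nondecreasing_measurable.
by move=> x x0; apply: fnd; rewrite (le_trans _ x0)// oppr_le0 /drift.
Qed.

(** A step belongs to component [j] with probability [mass j]; otherwise it is
    at least [- A], whatever its component. *)
Lemma ge_integral_step_law (f : R -> R) j (r : R) :
  {homo f : x y / x <= y} -> (forall x, 0 <= f x) -> 0 <= r ->
  (r%:E <= \int[expo (rate j)]_x (f x)%:E)%E ->
  (((1 - (mass j)%:num) * f (- A) + (mass j)%:num * r)%:E <=
   \int[F]_x (f x)%:E)%E.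
Proof.
move=> fnd f0 r0 rle.
have mf : measurable_fun setT f by exact: nondecreasing_measurable.
pose c := f (- A); have c0 : 0 <= c by exact: f0.
have cle i := ge_integral_expo i fnd f0.
rewrite ge0_integral_step_law//.
pose X := (\sum_(i <oo) ((mass i)%:num * (if i == j then r else c))%:E)%E.
have XE : X = (t0 * c + (mass j)%:num * r - (mass j)%:num * c)%:E.
  have : (X + ((mass j)%:num * c)%:E = (t0 * c + (mass j)%:num * r)%:E)%E.
    rewrite -(@series_single _ j ((mass j)%:num * c)) ?mulr_ge0// -series_EFinD; last 2 first.
    - by move=> i; rewrite mulr_ge0//; case: ifP.
    - by move=> i; case: ifP => // _; rewrite mulr_ge0.
    transitivity (\sum_(i <oo) (c * (mass i)%:num + (if i == j then (mass j)%:num * r else 0))%:E)%E.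
      by apply: eq_eseriesr => i _; congr (_%:E); case: eqP => [->|_]; ring.
    rewrite series_EFinD; last 2 first.
    - by move=> i; rewrite mulr_ge0.
    - by move=> i; case: ifP => // _; rewrite mulr_ge0.
    rewrite series_EFinZ// mass_series series_single ?mulr_ge0//.
    by rewrite -EFinM -EFinD mulrC.
  by move=> /(congr1 (fun u => (u - ((mass j)%:num * c)%:E)%E)); rewrite addeK// -EFinB.
apply: (@le_trans _ _ (((1 - t0) * c)%:E + X)%E).
  by rewrite XE -EFinD lee_fin; apply: eq_imp_le; rewrite -/c; ring.
rewrite leeD2l//; apply: lee_nneseries => [i _ _|i _].
  by rewrite lee_fin mulr_ge0//; case: ifP.
rewrite EFinM; apply: lee_wpmul2l; first by rewrite lee_fin.
by case: eqP => [->|_]; [exact: rle|exact: cle].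
Qed.

Lemma le_integral_step_law (f : R -> R) :
  {homo f : x y / x <= y} -> (forall x, 0 <= f x) ->
  ((f (- A))%:E <= \int[F]_x (f x)%:E)%E.
Proof.
move=> fnd f0; apply: le_trans (ge_integral_step_law fnd f0 (f0 _) (ge_integral_expo 0 fnd f0)).
by rewrite lee_fin; lra.
Qed.

Lemma convolution_pow_tailS n x :
  ((tail (convolution_pow F n.+1) x)%:E =
   \int[F]_y (tail (convolution_pow F n) (x - y))%:E)%E.
Proof. exact: convolution_taill. Qed.

Lemma convolution_pow_lower_bound n x :
  x < - (n%:R * A) -> tail (convolution_pow F n) x = 1.
Proof.
elim: n x => [|n ih] x.
  rewrite mul0r oppr0 => x0; change (\1_(`]x, +oo[%classic) 0 = 1 :> R).
  by rewrite indicE mem_setE in_itv/= x0.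
move=> xn; apply/eqP; rewrite eq_le tail_le1/= -lee_fin convolution_pow_tailS.
apply: le_trans (le_integral_step_law (@nondecreasing_tail_subr R _ x) _); last first.
  by move=> y; exact: tail_ge0.
by rewrite ih// -ltrBrDr; move: xn; rewrite -natr1; lra.
Qed.

(** Levels are measured from the lowest value [- n A] of the sum of [n] steps,
    so that a step outside component [j] leaves [y] unchanged.  Conditioning on
    the last step gives the count [n] of jumps by induction. *)
Lemma one_jump_lower_bound j n y : 0 <= y ->
  n%:R * (mass j)%:num * (1 - (mass j)%:num) ^+ n * expR (- (rate j)%:num * y) <=
  tail (convolution_pow F n) (y - n%:R * A).
Proof.
move=> y0; have w0 : 0 <= (mass j)%:num :> R by exact: mass_ge0.
have w1 := @mass_le1 R j.
elim: n => [|n ih]; first by rewrite !mul0r tail_ge0.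
rewrite -lee_fin convolution_pow_tailS.
pose f v := tail (convolution_pow F n) (y - n.+1%:R * A - v).
have hr : ((expR (- (rate j)%:num * y))%:E <= \int[expo (rate j)]_v (f v)%:E)%E.
  apply: (@le_trans _ _ (\int[expo (rate j)]_v (\1_(`]y, +oo[) v)%:E)%E).
    by rewrite integral_indic// setIT [leRHS]expo_tail max_r.
  apply: ge0_integral_expo_le => //.
  - exact: measurable_tail_subr.
  - by move=> v; exact: tail_ge0.
  move=> v _; rewrite indicE mem_setE in_itv/= andbT /f.
  have [yv|yv] := ltP y v; last exact: tail_ge0.
  by rewrite convolution_pow_lower_bound// -natr1 /drift; lra.
apply: le_trans (ge_integral_step_law (@nondecreasing_tail_subr R _ _) _ _ hr).
- rewrite lee_fin.
  have -> : y - n.+1%:R * A - - A = y - n%:R * A by rewrite -natr1; ring.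
  set E := expR _ in ih *; set w := (mass j)%:num in w0 w1 ih *.
  have E0 : 0 <= E by exact: expR_ge0.
  have u : (1 - w) ^+ n.+1 <= 1 by rewrite exprn_ile1//; lra.
  have h1 : (1 - w) * (n%:R * w * (1 - w) ^+ n * E) <=
            (1 - w) * tail (convolution_pow F n) (y - n%:R * A).
    by rewrite ler_wpM2l//; lra.
  have h2 : w * (1 - w) ^+ n.+1 * E <= w * E.
    by rewrite ler_wpM2r// -[leRHS]mulr1 ler_wpM2l.
  have -> : n.+1%:R * w * (1 - w) ^+ n.+1 * E =
     (1 - w) * (n%:R * w * (1 - w) ^+ n * E) + w * (1 - w) ^+ n.+1 * E.
    by rewrite exprS -natr1; ring.
  lra.
- by move=> v; exact: tail_ge0.
- exact: expR_ge0.
Qed.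

(** Same induction: the last step either is outside component [j], or is the
    second of two jumps from it, and the first is then supplied by
    [one_jump_lower_bound]. *)
Lemma two_jump_lower_bound j n z : 0 <= z ->
  n%:R * (n%:R - 1) / 2 * (mass j)%:num ^+ 2 * (1 - (mass j)%:num) ^+ n *
    ((rate j)%:num * z * expR (- (rate j)%:num * z)) <=
  tail (convolution_pow F n) (z - n%:R * A).
Proof.
move=> z0; have w0 : 0 <= (mass j)%:num :> R by exact: mass_ge0.
have w1 := @mass_le1 R j.
elim: n => [|n ih]; first by rewrite !mul0r tail_ge0.
rewrite -lee_fin convolution_pow_tailS.
pose f v := tail (convolution_pow F n) (z - n.+1%:R * A - v).
pose C := n%:R * (mass j)%:num * (1 - (mass j)%:num) ^+ n * expR (- (rate j)%:num * z) : R.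
have C0 : 0 <= C by rewrite !mulr_ge0 ?expR_ge0// exprn_ge0// subr_ge0.
have hr : ((C * ((rate j)%:num * z))%:E <= \int[expo (rate j)]_v (f v)%:E)%E.
  have mh : measurable_fun setT (fun v : R => expR ((rate j)%:num * v) * \1_(`[0, z]) v).
    by apply: measurable_funM => //; exact: measurable_expRM.
  apply: (@le_trans _ _ (\int[expo (rate j)]_v
      (C * (expR ((rate j)%:num * v) * \1_(`[0%R, z]) v))%:E)%E).
    under eq_integral do rewrite EFinM.
    rewrite ge0_integralZl//; last exact/measurable_EFinP.
    by rewrite expo_truncated_mgf// EFinM.
  apply: ge0_integral_expo_le => //.
  - exact: measurable_funM.
  - exact: measurable_tail_subr.
  - by move=> v; apply: mulr_ge0 => //; apply: mulr_ge0 => //; exact: expR_ge0.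
  - by move=> v; exact: tail_ge0.
  move=> v v0; rewrite indicE mem_setE in_itv/= v0/= /f.
  have [vz|vz] := leP v z; last by rewrite !mulr0 tail_ge0.
  rewrite mulr1; apply: (@le_trans _ _ (tail (convolution_pow F n) ((z - v) - n%:R * A))).
    apply: le_trans (one_jump_lower_bound j n _); last by rewrite subr_ge0.
    have -> : expR (- (rate j)%:num * (z - v)) =
        expR (- (rate j)%:num * z) * expR ((rate j)%:num * v).
      by rewrite -expRD; congr expR; ring.
    by rewrite /C; apply: eq_imp_le; ring.
  by apply: tail_nonincreasing; rewrite -natr1 /drift; lra.
apply: le_trans (ge_integral_step_law (@nondecreasing_tail_subr R _ _) _ _ hr).
- rewrite lee_fin.
  have -> : z - n.+1%:R * A - - A = z - n%:R * A by rewrite -natr1; ring.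
  rewrite /C; set E := expR _ in ih *; set w := (mass j)%:num in w0 w1 ih *.
  set r := (rate j)%:num * z in ih *.
  have E0 : 0 <= E by exact: expR_ge0.
  have r0 : 0 <= r by exact: mulr_ge0.
  have u0 : 0 <= (1 - w) ^+ n by rewrite exprn_ge0//; lra.
  have h1 : (1 - w) * (n%:R * (n%:R - 1) / 2 * w ^+ 2 * (1 - w) ^+ n * (r * E)) <=
            (1 - w) * tail (convolution_pow F n) (z - n%:R * A).
    by rewrite ler_wpM2l//; lra.
  have h2 : n%:R * w ^+ 2 * (1 - w) ^+ n * (r * E) * (1 - w) <= n%:R * w ^+ 2 * (1 - w) ^+ n * (r * E) * 1.
    by rewrite ler_wpM2l ?mulr_ge0 ?exprn_ge0//; lra.
  have -> : n.+1%:R * (n.+1%:R - 1) / 2 * w ^+ 2 * (1 - w) ^+ n.+1 * (r * E) =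
     (1 - w) * (n%:R * (n%:R - 1) / 2 * w ^+ 2 * (1 - w) ^+ n * (r * E)) +
     n%:R * w ^+ 2 * (1 - w) ^+ n * (r * E) * (1 - w).
    by rewrite (exprS (1 - w)) -natr1; field.
  have -> : w * (n%:R * w * (1 - w) ^+ n * E * r) = n%:R * w ^+ 2 * (1 - w) ^+ n * (r * E) * 1.
    by ring.
  lra.
- by move=> v; exact: tail_ge0.
- by rewrite mulr_ge0// mulr_ge0.
Qed.

End sums_of_steps.

(** * Comparison at the crossing points *)

Section crossing.
Context {R : realType}.
Implicit Types (x y z : R) (j n : nat).

Local Notation F := (@step_law R).
Local Notation A := (@drift R).
Local Notation t0 := (@remaining_mass R 0).

(** The point where [exp (- x / n_j) / n_j^2 = 1 / n_{j+1}^2]. *)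
Definition crossing j : R := 2 * (scale j)%:R * ln ((scale j.+1)%:R / (scale j)%:R).

Let n_gt0 j : 0 < (scale j)%:R :> R.
Proof. by rewrite ltr0n scale_gt0. Qed.

Lemma crossing_scaled j :
  crossing j / (scale j)%:R = 2 * (ln (scale j.+1)%:R - ln (scale j)%:R).
Proof.
by rewrite /crossing ln_div ?posrE//; field; rewrite gt_eqF.
Qed.

Lemma ln_scale j : ln (scale j)%:R = (log_scale j)%:R * ln 2 :> R.
Proof. by rewrite natrX lnXn// mulr_natl. Qed.

Lemma ln2_gt0 : 0 < ln 2 :> R.
Proof. by rewrite ln_gt0// ltr1n. Qed.

(** With [a_j * a_{j+1} = n_j ^ 2] the exponent [2 (a_{j+1} - a_j) ln 2], at
    least [a_{j+1} ln 2], is [n_j^2 / ln n_j] up to the factor [ln 2 ^ 2]. *)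
Lemma crossing_scaled_ge j :
  (scale j)%:R ^+ 2 * ln 2 ^+ 2 / ln (scale j)%:R <= crossing j / (scale j)%:R.
Proof.
rewrite crossing_scaled !ln_scale.
have a0 : 0 < (log_scale j)%:R :> R by rewrite ltr0n log_scale_gt0.
have aa : (log_scale j.+1)%:R * (log_scale j)%:R = (scale j)%:R ^+ 2 :> R.
  by rewrite -natrM -natrX log_scaleM.
have a2 : 2 * (log_scale j)%:R <= (log_scale j.+1)%:R :> R.
  by rewrite -natrM ler_nat leq_log_scaleS.
rewrite -aa; have := ln2_gt0.
move: (log_scale j)%:R (log_scale j.+1)%:R (ln 2) a0 a2 => a a' l a0 a2 l0.
have -> : a' * a * l ^+ 2 / (a * l) = a' * l by field; rewrite !gt_eqF.
nra.
Qed.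

Lemma crossing_ge0 j : 0 <= crossing j.
Proof.
have := crossing_scaled_ge j.
rewrite ler_pdivlMr//; apply: le_trans; rewrite mulr_ge0 ?(ltW (n_gt0 j))//.
by rewrite divr_ge0 ?ln_ge0 ?ler1n ?scale_gt0// mulr_ge0// exprn_ge0// ?ltW ?ln2_gt0.
Qed.

Lemma crossing_ge j : (scale j)%:R * ln 2 <= crossing j.
Proof.
rewrite -ler_pdivlMl// mulrC crossing_scaled !ln_scale.
have a1 : 1 <= (log_scale j)%:R :> R by rewrite ler1n log_scale_gt0.
have a2 : 2 * (log_scale j)%:R <= (log_scale j.+1)%:R :> R.
  by rewrite -natrM ler_nat leq_log_scaleS.
have := ln2_gt0; nra.
Qed.

Lemma decay_crossing j :
  decay j (crossing j) = ((scale j)%:R / (scale j.+1)%:R) ^+ 2.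
Proof.
rewrite /decay rateE mulNr mulrC crossing_scaled.
have -> : - (2 * (ln (scale j.+1)%:R - ln (scale j)%:R)) =
  2%:R * ln ((scale j)%:R / (scale j.+1)%:R) :> R.
  by rewrite ln_div ?posrE//; ring.
by rewrite expRM_natl lnK// posrE divr_gt0.
Qed.

Lemma tail_step_law_series x : 0 <= x ->
  ((tail F x)%:E = \sum_(i <oo) ((mass i)%:num * decay i x)%:E)%E.
Proof.
move=> x0; rewrite tail_step_law// EFinM hyper_tail// -series_EFinZ; last first.
  by move=> i; rewrite mulr_ge0 ?decay_ge0.
apply: eq_eseriesr => i _; congr (_%:E); rewrite /= !mulrA mulfV ?mul1r//.
by rewrite gt_eqF// remaining_mass_gt0.
Qed.

(** An earlier scale is at most half of [n_j], so its exponent is at least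
    doubled: the decay is at most [(n_j / n_{j+1})^4], and [n_j^2 <= n_{j+1}]. *)
Lemma decay_crossing_lt i j : (i < j)%N ->
  decay i (crossing j) <= remaining_mass j.+1.
Proof.
move=> ij; have c0 := crossing_ge0 j.
have ni : 2 * (scale i)%:R <= (scale j)%:R :> R.
  have := @scaleR_ge2 R i; have := @scaleRS_ge R i.
  have : (scale i.+1)%:R <= (scale j)%:R :> R by rewrite ler_nat leq_scale.
  nra.
have h : decay i (crossing j) <= decay j (crossing j) ^+ 2.
  rewrite /decay -expRM_natl ler_expR !rateE.
  have : 2 * (scale j)%:R^-1 <= (scale i)%:R^-1 :> R.
    have := n_gt0 i; have := n_gt0 j; move: ni.
    move: (scale i)%:R (scale j)%:R => n N nN N0 n0.
    by rewrite ler_pdivrMr// mulrC ler_pdivlMr.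
  by move: c0; move: (crossing j) => c; nra.
apply: (le_trans h); rewrite decay_crossing /remaining_mass.
have := @scaleRS_ge R j; have := n_gt0 j; have := n_gt0 j.+1.
move: (scale j)%:R (scale j.+1)%:R => n N N0 n0 nN.
rewrite -exprM expr_div_n ler_pdivrMr ?exprn_gt0//.
have -> : N ^- 2 * N ^+ (2 * 2) = N ^+ 2 by field; rewrite gt_eqF.
by rewrite exprM; apply: lerXn2r; rewrite ?nnegrE ?exprn_ge0 ?(ltW N0) ?(ltW n0).
Qed.

(** Beyond component [j] only the total weight [t_{j+1}] is left, component [j]
    has decayed to it by the choice of the point, and the earlier components
    have decayed much further. *)
Lemma tail_step_law_crossing j : tail F (crossing j) <= 3 * remaining_mass j.+1.
Proof.
have c0 := crossing_ge0 j.
set T := remaining_mass j.+1; have T0 : 0 < T by exact: remaining_mass_gt0.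
rewrite -lee_fin tail_step_law_series//.
pose late i : R := if (j < i)%N then (mass i)%:num else 0.
have late0 i : 0 <= late i by rewrite /late; case: ifP.
have sum_late : (\sum_(i <oo) (late i)%:E = T%:E)%E.
  rewrite /T -mass_series [RHS]eseries_cond [RHS]eseries_mkcond.
  by apply: eq_eseriesr => i _; rewrite /late /=; case: ifP.
apply: (@le_trans _ _ (\sum_(i <oo) (T * (mass i)%:num + (if i == j then T else 0) + late i)%:E)%E).
  apply: series_EFin_le => i; first by rewrite mulr_ge0 ?decay_ge0.
  have Tm : 0 <= T * (mass i)%:num by rewrite mulr_ge0// ltW.
  have mi : (mass i)%:num * decay i (crossing j) <= (mass i)%:num.
    by rewrite -[leRHS]mulr1 ler_wpM2l// decay_le1.
  have [ij|ij|->] := ltngtP i j.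
  - rewrite addr0 -[leLHS]addr0 lerD// mulrC ler_wpM2r//.
    exact: decay_crossing_lt.
  - rewrite /late ij; lra.
  - have : (mass j)%:num * decay j (crossing j) <= T.
      have := @mass_le R j; rewrite decay_crossing /T /remaining_mass => mj.
      apply: (le_trans (ler_wpM2r _ mj)); first by rewrite exprn_ge0 ?divr_ge0.
      by apply: eq_imp_le; field; rewrite !gt_eqF.
    have := late0 j; have : 0 <= T * (mass j)%:num by rewrite mulr_ge0// ltW.
    lra.
have Tm i : 0 <= T * (mass i)%:num by rewrite mulr_ge0// ltW.
rewrite series_EFinD//; last first.
  by move=> i; rewrite addr_ge0//; case: ifP => // _; exact: ltW.
rewrite series_EFinD//; last by move=> i; case: ifP => // _; exact: ltW.
rewrite series_EFinZ// mass_series series_single ?(ltW T0)// sum_late.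
rewrite -EFinM -!EFinD lee_fin.
have := @remaining_mass_le R 0; nra.
Qed.

Lemma bernoulli_ineq (w : R) n : 0 <= w <= 1 -> 1 - n%:R * w <= (1 - w) ^+ n.
Proof.
move=> /andP[w0 w1]; elim: n => [|n ih]; first by rewrite mul0r subr0.
have : (1 - w) * (1 - n%:R * w) <= (1 - w) ^+ n.+1.
  by rewrite exprS ler_wpM2l// subr_ge0.
have : 0 <= n%:R * w ^+ 2 by rewrite mulr_ge0// exprn_ge0.
rewrite -natr1; lra.
Qed.

(** [9/128] is [1/4 * (3/4)^2 * 1/2]: the number of pairs relative to [n^2], the
    two jump weights, and the other steps avoiding the component; one more
    factor [1/3] comes from [tail_step_law_crossing]. *)
Definition excess_constant : R := 3 / 128 * expR (- A) * ln 2 ^+ 2.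

Lemma excess_constant_gt0 : 0 < excess_constant.
Proof. by rewrite mulr_gt0 ?exprn_gt0 ?ln2_gt0// mulr_gt0 ?expR_gt0. Qed.

(** Here [t] is the tail at the crossing point [n x], [w] the weight of the
    component, [B] the probability that [n] steps avoid it, [E = exp (- 16)]
    and [l = ln 2]. *)
Lemma excess_arithmetic (n N t x B w E l L a : R) :
  t <= 3 * N ^- 2 -> n ^+ 2 * l ^+ 2 / L <= x -> 3 / 4 * n ^- 2 <= w -> 1 / 2 <= B ->
  2 <= n -> 0 < N -> 0 < L -> 0 <= E -> 0 <= t -> 0 <= a ->
  3 / 128 * E * l ^+ 2 * (n ^+ 2 / L) * t <=
  n * (n - 1) / 2 * w ^+ 2 * B * ((x + a) * (E * (n / N) ^+ 2)).
Proof.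
move=> tN; set X := n ^+ 2 * l ^+ 2 / L => Xx wn B2 n2 N0 L0 E0 t0' a0.
have n0 : 0 < n by lra.
have X0 : 0 <= X by rewrite divr_ge0 ?(ltW L0)// mulr_ge0 ?sqr_ge0.
have i0 : 0 < n ^- 2 by rewrite invr_gt0 exprn_gt0.
have w2 : 9 / 16 * n ^- 4 <= w ^+ 2.
  have -> : 9 / 16 * n ^- 4 = (3 / 4 * n ^- 2) ^+ 2 by field; rewrite gt_eqF.
  by apply: lerXn2r => //; rewrite nnegrE; lra.
have i4 : 0 <= n ^- 4 by rewrite invr_ge0 exprn_ge0// ltW.
have nn : n ^+ 2 / 4 <= n * (n - 1) / 2 by nra.
have pair : n ^+ 2 / 4 * (9 / 16 * n ^- 4) * (1 / 2) <= n * (n - 1) / 2 * w ^+ 2 * B.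
  apply: ler_pM => //; last (apply: ler_pM => //); rewrite ?mulr_ge0 ?exprn_ge0 ?(ltW n0)//.
have -> : 3 / 128 * E * l ^+ 2 * (n ^+ 2 / L) * t = 3 / 128 * E * X * t.
  by rewrite /X; ring.
apply: (@le_trans _ _ (3 / 128 * E * X * (3 * N ^- 2))).
  by apply: ler_wpM2l => //; apply: mulr_ge0 => //; exact: mulr_ge0.
have -> : 3 / 128 * E * X * (3 * N ^- 2) =
    n ^+ 2 / 4 * (9 / 16 * n ^- 4) * (1 / 2) * (X * (E * (n / N) ^+ 2)).
  by field; rewrite !gt_eqF.
have s0 : 0 <= E * (n / N) ^+ 2 by apply: mulr_ge0 => //; rewrite exprn_ge0// divr_ge0 ?(ltW n0) ?(ltW N0).
apply: ler_pM => //.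
- by rewrite !mulr_ge0 ?exprn_ge0 ?(ltW n0).
- by rewrite mulr_ge0.
- by apply: ler_wpM2r => //; lra.
Qed.

(** Measured from the lowest value of the sum, the crossing point becomes
    [x + 16 n]; the shift multiplies the decay of component [j] by [exp (- 16)]
    since its rate is [1 / n]. *)
Lemma convolution_pow_crossing j :
  excess_constant * ((scale j)%:R ^+ 2 / ln (scale j)%:R) * tail F (crossing j) <=
  tail (convolution_pow F (scale j)) (crossing j).
Proof.
have c0 := crossing_ge0 j; have A0 : 0 < A by rewrite /drift.
have nA0 : 0 <= (scale j)%:R * A by rewrite mulr_ge0 ?ltW.
have z0 : 0 <= crossing j + (scale j)%:R * A by rewrite addr_ge0.
have := two_jump_lower_bound j (scale j) z0; rewrite addrK.
apply: le_trans.
have Fc := tail_step_law_crossing j.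
have cge := crossing_scaled_ge j.
have wge := @mass_ge R j; have wle := @mass_le R j.
have lnn : 0 < ln (scale j)%:R :> R by rewrite ln_gt0// ltr1n scale_gt1.
set w := (mass j)%:num in wge wle *.
have n2 := @scaleR_ge2 R j.
have w0 : 0 <= w by exact: mass_ge0.
have half : 1 / 2 <= (1 - w) ^+ scale j.
  have w01 : 0 <= w <= 1.
    by rewrite w0/= mass_le1.
  apply: le_trans (bernoulli_ineq _ w01).
  have : (scale j)%:R * w <= (scale j)%:R^-1.
    by apply: (le_trans (ler_wpM2l _ wle)); [exact: ltW|];
      rewrite /remaining_mass exprS invfM mulVKf ?gt_eqF.
  have : (scale j)%:R^-1 <= 1 / 2 :> R by rewrite mul1r lef_pV2 ?posrE.
  lra.
have -> : (rate j)%:num * (crossing j + (scale j)%:R * A) *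
     expR (- (rate j)%:num * (crossing j + (scale j)%:R * A)) =
     (crossing j / (scale j)%:R + A) * (expR (- A) * ((scale j)%:R / (scale j.+1)%:R) ^+ 2).
  rewrite -decay_crossing /decay -expRD rateE.
  by congr (_ * expR _); field; rewrite gt_eqF.
apply: (excess_arithmetic Fc cge wge half) => //; rewrite ?expR_ge0 ?tail_ge0 ?(ltW A0)//.
Qed.

End crossing.

Theorem theorem4 (R : realType) :
  exists (F : distr R) (c : R) (n : nat -> nat) (x : nat -> R),
    subexponential F /\
    F.-integrable [set: R] (fun t : R => t%:E) /\
    ('E_F[fun t : R => t] < 0)%E /\
    0 < c /\
    (forall k : nat, (1 < n k)%N) /\
    n k @[k --> \oo] --> \oo /\
    x k @[k --> \oo] --> +oo /\
    (forall k : nat,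
       c * ((n k)%:R ^+ 2 / ln ((n k)%:R)) * tail F (x k)
       <= tail (convolution_pow F (n k)) (x k)).
Proof.
exists (@step_law R), (@excess_constant R), scale, (@crossing R).
split; first exact: step_law_subexponential.
split; first exact: step_law_integrable.
split; first exact: step_law_mean_lt0.
split; first exact: excess_constant_gt0.
split; first exact: scale_gt1.
split.
  apply/cvgnyPge => m; near=> k.
  by apply: leq_trans (ltnW (ltn_scale k)); near: k; exact: nbhs_infty_ge.
split; last exact: convolution_pow_crossing.
apply/cvgryPge => M; near=> k.
apply: le_trans (crossing_ge k).
have kM : M / ln 2 <= k%:R.
  by near: k; exact: nbhs_infty_ger.
rewrite -ler_pdivrMr ?ln2_gt0//; apply: (le_trans kM).
by rewrite ler_nat ltnW// ltn_scale.
Unshelve. all: by end_near. Qed.
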